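(* Let $m\ge 1$ and $k\ge 1$ be integers with $k\le 9$ or $m\le 2$. Then there exist (linearly) $k$-regular continuous maps $\mathbb{R}^m \to \mathbb{R}^{m(k-1)+1}$ and $\mathbb{C}^m \to \mathbb{C}^{m(k-1)+1}$.
   Context: For $\mathbb{F}\in\{\mathbb{R},\mathbb{C}\}$, a continuous map $f\colon \mathbb{F}^m\to\mathbb{F}^N$ is called (linearly) $k$-regular if for any $k$ pairwise distinct points $p_1,\dots,p_k\in\mathbb{F}^m$ the vectors $f(p_1),\dots,f(p_k)$ are linearly independent over $\mathbb{F}$. *)

(* Defs.v *)
From HB Require Import structures.
From mathcomp Require Import all_boot all_order all_algebra.
From mathcomp Require Import complex.
From mathcomp Require Import all_classical all_reals all_analysis.
Set Implicit Arguments. Unset Strict Implicit. Unset Printing Implicit Defensive.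
Import Order.TTheory GRing.Theory Num.Theory.
Import numFieldNormedType.Exports.
Local Open Scope ring_scope.

Definition k_regular (F : fieldType) (m N k : nat) (f : 'rV[F]_m -> 'rV[F]_N) : Prop :=
  forall p : 'I_k -> 'rV[F]_m, injective p -> row_free (\matrix_(i < k) f (p i)).

(* Topology on C = R[i] (real-closed's complex numbers over R): the standard
   one, induced by the complex modulus `|z| (copied from the generic
   numFieldType normed structure of MathComp-Analysis on R[i]^o).
   C^m = 'rV[R[i]]_m then carries the product (sup-norm) topology. *)
Local Open Scope complex_scope.
HB.instance Definition _ (R : rcfType) := NormedModule.copy R[i] R[i]^o.

(* Main.v *)
Require Import Defs.
From HB Require Import structures.
From mathcomp Require Import all_boot all_order perm all_algebra.
From mathcomp Require Import complex.
From mathcomp Require Import all_classical all_reals all_analysis.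
From mathcomp Require Import zify ring.
Set Implicit Arguments. Unset Strict Implicit. Unset Printing Implicit Defensive.
Import Order.TTheory GRing.Theory Num.Theory.
Import numFieldNormedType.Exports.
Local Open Scope ring_scope.
Local Open Scope complex_scope.

(* Compose a shrinking map z |-> e z / (1 + |z|) with all monomials of degree < k and then with a
   linear map L onto K^N, N = m(k-1)+1.  If this fails for every e > 0, normalised dependencies
   sum_i lambda_i ev(p_i) between values at points tending to 0 have a limit functional phi <> 0
   that is killed by L, vanishes on monomials of degree >= k and has Hankel rank <= k; so phi is
   carried by a local Gorenstein algebra of length r <= k.  The cone of such phi has dimension at
   most N, hence a generic L does not vanish on it.
   Dimension is measured by transcendence degree, and "generic" means that the (real) entries of
   L are algebraically independent.  The bound on the dimension is proved by induction on k.  Let M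
   be the maximal ideal of the algebra.  If an element z with z M^2 = 0 has z^2 <> 0, then phi is
   the sum of a square of a linear form and of a functional of length r - 1.  Otherwise the
   annihilator of M^2 is isotropic, so the embedding dimension n satisfies 2n + 2 <= r; hence n = 3
   if n > 2, which leaves cubics in 3 variables (r = 8) or cubics plus a fourth power (r = 9).  For
   n = 2 one parametrizes pairs of commuting nilpotent matrices with a cyclic vector. *)

(** * Algebraic dependence *)

(** Transcendence degree replaces dimension so that no family of algebras has to be parametrized:
    the bound concerns one functional at a time and says that all its values lie in [acl u] for some
    [u] of at most N elements. The number m(k-1)+1 arises as follows. One letter costs r parameters
    and two letters cost 2r-1, that is n(r-1)+1 for n = 1, 2; each further letter costs its r-1
    coordinates in the maximal ideal. The condition k <= 9 matters when n > 2 and no square splits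
    off: then 2n+2 <= r <= 9 forces n = 3, whereas n = 4 would be possible at r = 10. Splitting off
    a square without an extra parameter takes a square root, so the bound is proved over an
    algebraically closed field. The entries of L are nevertheless real, so that one L serves both
    statements; real points are viewed as complex ones. *)

Section AlgebraicOverSubfield.
Variables (E : fieldType) (K : divringClosed E).

(** [K] repackaged as a field, so that [algebraicOver] applies along the inclusion [val]. *)
Inductive subfield_sort := SubfieldSort x & x \in K.
Definition subfield_val u := let: SubfieldSort x _ := u in x.

HB.instance Definition _ := [isSub for subfield_val].
HB.instance Definition _ := [Choice of subfield_sort by <:].
HB.instance Definition _ := [SubChoice_isSubIntegralDomain of subfield_sort by <:].
HB.instance Definition _ := [SubIntegralDomain_isSubField of subfield_sort by <:].

Definition algebraic_over (x : E) :=
  exists2 p : {poly E}, p \is a polyOver K & (p != 0) && root p x.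

Lemma algebraic_overP x : algebraic_over x <-> algebraicOver (val : subfield_sort -> E) x.
Proof.
split=> [[p /polyOverP Kp /andP[p0 px]] | [p p0 px]].
  exists (\poly_(i < size p) (Sub p`_i (Kp i) : subfield_sort)).
    apply: contraNneq p0 => /(congr1 (fun q => map_poly val q)) q0.
    suff -> : p = map_poly val (\poly_(i < size p) (Sub p`_i (Kp i) : subfield_sort)).
      by rewrite q0 rmorph0.
    apply/polyP=> i; rewrite coef_map coef_poly /=; case: ltnP => [_|/leq_sizeP->//].
    by rewrite SubK.
  suff -> : map_poly val (\poly_(i < size p) (Sub p`_i (Kp i) : subfield_sort)) = p by [].
  apply/polyP=> i; rewrite coef_map coef_poly /=; case: ltnP => [_|/leq_sizeP->//].
  by rewrite SubK.
exists (map_poly val p); last by rewrite map_poly_eq0 p0.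
by apply/polyOverP=> i; rewrite coef_map /= (valP (p`_i)).
Qed.

Lemma algebraic_over_id x : x \in K -> algebraic_over x.
Proof.
move=> Kx; exists ('X - x%:P); first by rewrite polyOverXsubC.
by rewrite polyXsubC_eq0 root_XsubC eqxx.
Qed.

Lemma algebraic_over_divring : divring_closed [pred x | `[< algebraic_over x >]].
Proof.
split=> [|x y|x y].
- exact/asboolP/algebraic_over_id/rpred1.
- move=> /asboolP/algebraic_overP ax /asboolP/algebraic_overP ay.
  exact/asboolP/algebraic_overP/algebraic_sub.
- move=> /asboolP/algebraic_overP ax /asboolP/algebraic_overP ay.
  exact/asboolP/algebraic_overP/algebraic_div.
Qed.

(** Over a field, algebraic and integral elements coincide, and integrality is transitive. *)
Lemma algebraic_over_root (p : {poly E}) x :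
  (forall i, algebraic_over p`_i) -> p != 0 -> root p x -> algebraic_over x.
Proof.
move=> Kp p0 px; apply/algebraic_overP/integral_algebraic.
apply: (integral_root p0 px) => _ /(nthP 0)[i _ <-].
exact/integral_algebraic/algebraic_overP.
Qed.

End AlgebraicOverSubfield.

Section AlgebraicClosureOfSeq.
Variable E : fieldType.
Implicit Types (u v : seq E) (x y a b : E).

Definition in_gen u x :=
  forall K : {pred E}, divring_closed K -> {subset u <= K} -> x \in K.
Definition gen u : {pred E} := [pred x | `[< in_gen u x >]].

Lemma gen_divring u : divring_closed (gen u).
Proof.
split=> [|x y|x y].
- by apply/asboolP=> K [].
- move=> /asboolP ux /asboolP uy; apply/asboolP=> K cK uK.
  by have [_ cB _] := cK; apply: cB; [apply: ux | apply: uy].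
- move=> /asboolP ux /asboolP uy; apply/asboolP=> K cK uK.
  by have [_ _ cD] := cK; apply: cD; [apply: ux | apply: uy].
Qed.
HB.instance Definition _ u := GRing.isDivringClosed.Build E (gen u) (gen_divring u).

(** Containment of a set in [acl u] stands for transcendence degree at most [size u] over the prime
    field. *)
Definition acl u : {pred E} := [pred x | `[< algebraic_over (gen u) x >]].
HB.instance Definition _ u :=
  GRing.isDivringClosed.Build E (acl u) (algebraic_over_divring (gen u)).

Lemma mem_gen u : {subset u <= gen u}.
Proof. by move=> x ux; apply/asboolP=> K _; apply. Qed.

Lemma gen_min u (K : {pred E}) :
  divring_closed K -> {subset u <= K} -> {subset gen u <= K}.
Proof. by move=> cK uK x /asboolP; apply. Qed.

Lemma gen_sub_acl u : {subset gen u <= acl u}.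
Proof. by move=> x ux; apply/asboolP/algebraic_over_id. Qed.

Lemma mem_acl u : {subset u <= acl u}.
Proof. by move=> x /mem_gen; apply: gen_sub_acl. Qed.

Lemma acl_root u (p : {poly E}) x :
  p \is a polyOver (acl u) -> p != 0 -> root p x -> x \in acl u.
Proof.
move=> /polyOverP Kp p0 px; apply/asboolP.
by apply: algebraic_over_root p0 px => i; apply/asboolP/Kp.
Qed.

Lemma acl_trans u v : {subset u <= acl v} -> {subset acl u <= acl v}.
Proof.
move=> uv x /asboolP[p /polyOverP Kp /andP[p0 px]].
apply: acl_root p0 px; apply/polyOverP=> i.
by apply: gen_min (Kp i) => //; exact: divringClosedP.
Qed.

Lemma acl_sub u v : {subset u <= v} -> {subset acl u <= acl v}.
Proof. by move=> uv; apply: acl_trans => x /uv; apply: mem_acl. Qed.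

Lemma gen_consP u a x : x \in gen (a :: u) ->
  exists p q : {poly E}, [/\ p \is a polyOver (gen u), q \is a polyOver (gen u),
    q.[a] != 0 & x = p.[a] / q.[a]].
Proof.
pose Q (x : E) := exists p q : {poly E},
  [/\ p \is a polyOver (gen u), q \is a polyOver (gen u), q.[a] != 0 & x = p.[a] / q.[a]].
move=> /(@gen_min _ [pred x | `[< Q x >]]) H; apply/asboolP; apply: H => [|y].
  split=> [|y z|y z].
  - by apply/asboolP; exists 1, 1; rewrite !rpred1 hornerC oner_eq0 divr1.
  - move=> /asboolP[p [q [Kp Kq q0 ->]]] /asboolP[p' [q' [Kp' Kq' q0' ->]]]; apply/asboolP.
    exists (p * q' - p' * q), (q * q').
    split; rewrite ?rpredB ?rpredM // ?hornerE ?mulf_neq0 //.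
    by rewrite -mulNr addf_div // mulNr.
  - move=> /asboolP[p [q [Kp Kq q0 ->]]] /asboolP[p' [q' [Kp' Kq' q0' ->]]]; apply/asboolP.
    have [p0|p0] := eqVneq p'.[a] 0.
      exists 0, 1; rewrite rpred0 rpred1 hornerC oner_eq0 p0; split=> //.
      by rewrite horner0 !mul0r invr0 mulr0.
    exists (p * q'), (q * p'); split; rewrite ?rpredM // ?hornerE ?mulf_neq0 //.
    by rewrite invf_div mulf_div.
rewrite in_cons => /predU1P[->|uy]; apply/asboolP.
  by exists 'X, 1; rewrite polyOverX rpred1 hornerX hornerC oner_eq0 divr1.
exists y%:P, 1; rewrite rpred1 !hornerC oner_eq0 divr1; split=> //.
by rewrite polyOverC mem_gen.
Qed.


(** Steinitz exchange: a relation for [x] over the field generated by [u] and [a] is, up to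
    denominators, a polynomial relation between [x] and [a]; reordered by powers of [a] it makes [a]
    algebraic over [x :: u]. *)
Lemma acl_exchange u a x : x \in acl (a :: u) -> x \notin acl u -> a \in acl (x :: u).
Proof.
move=> /asboolP[p /polyOverP Kp /andP[p0 px]] Nx.
have [N /choice[d NdP]] := choice (fun i => gen_consP (Kp i)).
(* clear denominators: [P(a, x) = 0] with [P] in two variables over [gen u] *)
pose e i := \prod_(j < size p | j != i :> nat) d j.
pose c i := N i * e i.
have Kc i : c i \is a polyOver (gen u).
  rewrite rpredM //; first by case: (NdP i).
  by apply: rpred_prod => j _; case: (NdP j).
have d0 i : (d i).[a] != 0 by case: (NdP i).
pose dd := \prod_(j < size p) (d j).[a].
have dd0 : dd != 0 by rewrite prodf_seq_neq0; apply/allP=> j _; apply: d0.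
have cE i : (i < size p)%N -> (c i).[a] = p`_i * dd.
  move=> ip; rewrite /c hornerM /e horner_prod /dd.
  rewrite [in RHS](bigD1 (Ordinal ip)) //=; case: (NdP i) => _ _ _ ->.
  by rewrite mulrA divfK.
pose Q := \sum_(i < size p) x ^+ i *: c i.
have KQ : Q \is a polyOver (acl (x :: u)).
  apply: rpred_sum => i _; apply/polyOverP=> j; rewrite coefZ rpredM //.
    by rewrite rpredX // mem_acl // mem_head.
  apply: (@acl_sub u); first by move=> y uy; rewrite in_cons uy orbT.
  by apply: gen_sub_acl; apply: (polyOverP (Kc i)).
apply: (acl_root KQ).
  (* If the reordered polynomial were zero, the coefficients of a single power of [a] would form a
     nonzero polynomial over [gen u] with root [x]. *)
  apply: contra Nx => /eqP Q0.
  have [i ip] : exists i, (i < size p)%N /\ p`_i != 0.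
    exists (size p).-1; rewrite -lead_coefE lead_coef_eq0 p0; split=> //.
    by rewrite prednK // size_poly_gt0.
  case: ip => ip pi0.
  have [j cj] : exists j, (c i)`_j != 0.
    have : c i != 0.
      by apply: contraTneq (mulf_neq0 pi0 dd0) => c0; rewrite -cE // c0 horner0 eqxx.
    by rewrite -lead_coef_eq0; exists (size (c i)).-1.
  pose q := \poly_(l < size p) (c l)`_j.
  apply: (@acl_root _ q).
  - apply/polyOverP=> l; rewrite coef_poly; case: ifP => _; last exact: rpred0.
    by apply: gen_sub_acl; apply: (polyOverP (Kc l)).
  - apply: contraTneq cj => q0; rewrite negbK.
    by have := coef_poly (size p) (fun l => (c l)`_j) i; rewrite -/q q0 coef0 ip => <-.
  - rewrite rootE horner_poly; apply/eqP.
    transitivity Q`_j; last by rewrite Q0 coef0.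
    by rewrite coef_sum; apply: eq_bigr => l _; rewrite coefZ mulrC.
rewrite rootE horner_sum; apply/eqP.
transitivity (dd * p.[x]); last by rewrite (rootP px) mulr0.
rewrite horner_coef mulr_sumr; apply: eq_bigr => i _.
by rewrite hornerZ cE // mulrC mulrAC mulrC.
Qed.

Fixpoint indep (T : seq E) : Prop :=
  if T is x :: T' then x \notin acl T' /\ indep T' else True.

Lemma indep_complete T u : indep T -> {subset T <= acl u} ->
  exists v, (size T + size v <= size u)%N /\ {subset acl u <= acl (T ++ v)}.
Proof.
elim: T => [|x T IH] /=; first by move=> _ _; exists u; split; [rewrite add0n | move=> y].
move=> [NxT iT] Tu.
have [v [sv uv]] : exists v, (size T + size v <= size u)%N /\ {subset acl u <= acl (T ++ v)}.
  by apply: IH => // y yT; apply: Tu; rewrite in_cons yT orbT.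
have : x \in acl (T ++ v) by apply/uv/Tu/mem_head.
(* Elements of [v] are moved to [v2] one by one until the next one, [b], makes [x] dependent; this
   [b] is exchanged for [x]. *)
suff H v1 v2 : x \in acl (T ++ v1 ++ v2) -> x \notin acl (T ++ v2) ->
    exists v3, (size v3 < size v1 + size v2)%N /\
    {subset acl (T ++ v1 ++ v2) <= acl (x :: T ++ v3)}.
  move=> xv; have := H v [::]; rewrite !cats0 addn0 => /(_ xv NxT)[v3 [s3 H3]].
  by exists v3; split; [apply: leq_trans sv; rewrite addSnnS leq_add2l | move=> y /uv/H3].
elim: v1 v2 => [|b v1 IHv] v2 xv Nv; first by rewrite xv in Nv.
have catE w : {subset acl (T ++ w) <= acl (w ++ T)}.
  by apply: acl_sub => y; rewrite !mem_cat orbC.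
have [xv'|Nxv] := boolP (x \in acl (T ++ b :: v2)); last first.
  have [|v3 [s3 H3]] := IHv (b :: v2) _ Nxv.
    by apply: acl_sub xv => y; rewrite !(mem_cat, in_cons); do ?case: (_ \in _); do ?case: (_ == _).
  exists v3; rewrite addSnnS; split=> // y yv; apply: H3; apply: acl_sub yv => z.
  by rewrite !(mem_cat, in_cons); do ?case: (_ \in _); do ?case: (_ == _).
have bx : b \in acl (x :: T ++ v2).
  apply: acl_exchange Nv; apply: acl_sub xv' => y.
  by rewrite !(mem_cat, in_cons); do ?case: (_ \in _); do ?case: (_ == _).
exists (v1 ++ v2); rewrite size_cat addSn; split=> //; apply: acl_trans => y.
rewrite !(mem_cat, in_cons) -!orbA => /or4P[yT|/eqP->|yv|yv]; last 2 first.
- by apply: mem_acl; rewrite !(in_cons, mem_cat) yv !orbT.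
- by apply: mem_acl; rewrite !(in_cons, mem_cat) yv !orbT.
- by apply: mem_acl; rewrite !(in_cons, mem_cat) yT !orbT.
by apply: acl_sub bx => z; rewrite !(in_cons, mem_cat) => /or3P[->|->|->]; rewrite ?orbT.
Qed.

Lemma indep_size T u : indep T -> {subset T <= acl u} -> (size T <= size u)%N.
Proof.
by move=> iT /(indep_complete iT)[v [sv _]]; apply: leq_trans sv; rewrite leq_addr.
Qed.

End AlgebraicClosureOfSeq.

(** * Functionals of finite local length *)

Section Functionals.
Variables (E : fieldType) (m : nat).
Implicit Types (phi : seq 'I_m -> E) (w : seq 'I_m).

Definition hankel phi s (a b : 'I_s -> seq 'I_m) : 'M[E]_s :=
  \matrix_(i, j) phi (a i ++ b j).

(* A functional on polynomials in [m] variables is given by its values on words, i.e. on monomials;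
   for such a [phi] of finite support, Hankel rank at most [k] means that the quotient of the
   polynomial ring by the largest ideal in the kernel of [phi] has length at most [k]. *)
Record lowrank k phi : Prop := Lowrank {
  lowrank_perm : forall w w', perm_eq w w' -> phi w = phi w';
  lowrank_nil : exists K, forall w, (K <= size w)%N -> phi w = 0;
  lowrank_minor : forall a b : 'I_k.+1 -> seq 'I_m, \det (hankel phi a b) = 0 }.

Definition wordmx r (X : 'I_m -> 'M[E]_r) w : 'M[E]_r :=
  foldr (fun i A => X i *m A) 1%:M w.

Lemma wordmx_cat r (X : 'I_m -> 'M[E]_r) w w' :
  wordmx X (w ++ w') = wordmx X w *m wordmx X w'.
Proof. by elim: w => [|i w IH] /=; rewrite ?mul1mx // IH mulmxA. Qed.

Lemma wordmx1 r (X : 'I_m -> 'M[E]_r) i : wordmx X [:: i] = X i.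
Proof. by rewrite /= mulmx1. Qed.

(* The local Gorenstein algebra of [phi], acting on itself through commuting nilpotent matrices [X i];
   [v] is its unit and [G] the pairing [(a, b) |-> phi (a b)]. *)
Record gorenstein r phi (X : 'I_m -> 'M[E]_r) (G : 'M[E]_r) (v : 'rV[E]_r) : Prop :=
 Gorenstein {
  gor_comm : forall i j, X i *m X j = X j *m X i;
  gor_sym : G^T = G;
  gor_unit : G \in unitmx;
  gor_adj : forall i, X i *m G = G *m (X i)^T;
  gor_nil : exists K, forall w, (K <= size w)%N -> wordmx X w = 0;
  gor_cyc : forall y : 'cV[E]_r, (forall w, v *m wordmx X w *m y = 0) -> y = 0;
  gor_phi : forall w, phi w = (v *m wordmx X w *m G *m v^T) 0 0 }.

Lemma schur_complement s (M : 'M[E]_s) (C : 'cV_s) (R : 'rV_s) (d : 'M[E]_1) :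
  M \in unitmx -> \det (block_mx M C R d) = 0 -> d = R *m invmx M *m C.
Proof.
move=> uM.
have -> : block_mx M C R d =
    block_mx 1%:M 0 (R *m invmx M) 1%:M *m block_mx M C 0 (d - R *m invmx M *m C).
  by rewrite mulmx_block !mul1mx !mul0mx !addr0 mulmxKV // addrC subrK.
rewrite det_mulmx det_lblock !det1 !mul1r det_ublock => /eqP.
rewrite mulf_eq0 => /orP[/eqP M0|].
  by move: uM; rewrite unitmxE M0 unitr0.
by rewrite det_mx11 mxE [X in _ + X]mxE subr_eq0 => /eqP e; apply/matrixP=> i j; rewrite !ord1.
Qed.

(** Macaulay's inverse systems in matrix form. Let [M] be a nonzero Hankel minor of maximal size
    [r]. All bordered minors vanish, so [phi (w ++ w')] depends only on the row [R w] and the column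
    [C w']. Hence [R w] serves as coordinates for the class of [w], and appending a letter acts
    linearly on it. *)
Lemma lowrank_gorenstein k phi : lowrank k phi ->
  exists r X G v, (r <= k)%N /\ @gorenstein r phi X G v.
Proof.
case=> permP [K nilP] minP.
pose ND s := exists a b : 'I_s -> seq 'I_m, \det (hankel phi a b) != 0.
have exN : exists s, ~~ `[< ND s >].
  by exists k.+1; apply/asboolPn => -[a [b]]; rewrite minP eqxx.
have ltk : forall s, (forall n, ~~ `[< ND n >] -> (s <= n)%N) -> (s <= k.+1)%N.
  by move=> s; apply; apply/asboolPn => -[a [b]]; rewrite minP eqxx.
case: (ex_minnP exN) => -[|r].
  by move/asboolPn; case; exists (fun _ => [::]), (fun _ => [::]); rewrite det_mx00 oner_neq0.
move=> /asboolPn NDr minr; have rk : (r <= k)%N by rewrite -ltnS; apply: ltk.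
have [a [b D0]] : ND r.
  by apply: contrapT => /asboolPn/minr; rewrite ltnn.
pose M := hankel phi a b.
have uM : M \in unitmx by rewrite unitmxE unitfE.
pose R w : 'rV_r := \row_j phi (w ++ b j).
pose C w : 'cV_r := \col_i phi (a i ++ w).
have phiE w w' : phi (w ++ w') = (R w *m invmx M *m C w') 0 0.
  suff /(schur_complement uM) <- : \det (block_mx M (C w') (R w) (phi (w ++ w'))%:M) = 0.
    by rewrite mxE eqxx.
  pose a' (i : 'I_(r + 1)) := if fintype.split i is inl i then a i else w.
  pose b' (i : 'I_(r + 1)) := if fintype.split i is inl i then b i else w'.
  have -> : block_mx M (C w') (R w) (phi (w ++ w'))%:M = hankel phi a' b'.
    apply/matrixP=> i j; rewrite !mxE /a' /b'.
    by case: (fintype.split i) => i'; rewrite !mxE; case: (fintype.split j) => j'; rewrite !mxE ?ord1 ?eqxx.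
  apply: contrapT => /eqP D1; apply: NDr.
  by rewrite -addn1; exists a', b'.
have [X RX] : exists X : 'I_m -> 'M[E]_r, forall w c, R w *m X c = R (rcons w c).
  exists (fun c => invmx M *m \matrix_(i, j) phi (a i ++ c :: b j)) => w c.
  rewrite mulmxA; apply/rowP=> j; rewrite mxE [RHS]mxE cat_rcons phiE [RHS]mxE.
  by apply: eq_bigr => i _; congr (_ * _); rewrite !mxE.
have RW w w' : R w *m wordmx X w' = R (w ++ w').
  elim: w' w => [|c w' IH] w; first by rewrite mulmx1 cats0.
  by rewrite /= mulmxA RX IH cat_rcons.
have MR : M = \matrix_i R (a i) by apply/matrixP=> i j; rewrite !mxE.
have CA w : (C w)^T = R w *m (invmx M *m \matrix_(i, j) phi (a i ++ a j)).
  rewrite mulmxA; apply/rowP=> i; rewrite mxE mxE [RHS]mxE.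
  rewrite (permP _ (w ++ a i)); last by rewrite perm_catC.
  by rewrite phiE mxE; apply: eq_bigr => j _; congr (_ * _); rewrite !mxE.
pose A : 'M[E]_r := \matrix_(i, j) phi (a i ++ a j).
have AT : A^T = A by apply/matrixP=> i j; rewrite !mxE; apply: permP; rewrite perm_catC.
have [G [GT RGR]] : exists G : 'M[E]_r, G^T = G /\
    forall w w', R w *m G *m (R w')^T = (phi (w ++ w'))%:M.
  (* Since [phi] ignores the order of letters, [C w'] is the transpose of [R w' M^-1 A];
     substituting this in [phiE] produces [G]. *)
  exists (invmx M *m A *m (invmx M)^T); split=> [|w w'].
    by rewrite !trmx_mul trmxK AT mulmxA.
  apply/matrixP=> i j; rewrite !ord1 [RHS]mxE eqxx mulr1n phiE; congr (_ 0 0).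
  rewrite -(trmxK (C w')) CA !trmx_mul AT -!mulmxA; do !congr (_ *m _).
have cyc (y : 'cV_r) : (forall w, R w *m y = 0) -> y = 0.
  move=> Hy; have : M *m y = 0.
    by apply/row_matrixP=> i; rewrite row_mul MR rowK Hy row0.
  by move/(congr1 (mulmx (invmx M))); rewrite mulKmx // mulmx0.
have cycM n (B D : 'M[E]_(r, n)) : (forall w, R w *m B = R w *m D) -> B = D.
  move=> H; apply/matrixP=> i j; have : col j (B - D) = 0.
    by apply: (cyc _) => w; rewrite colE mulmxA mulmxBr H subrr mul0mx.
  by move/matrixP/(_ i 0); rewrite !mxE => /subr0_eq.
exists r, X, G, (R [::]); split=> //; split=> //.
- move=> i j; apply: (@cycM _ _ _) => w; rewrite !mulmxA !RX; apply/rowP=> l; rewrite !mxE.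
  by apply: permP; rewrite perm_cat2r -!cats1 -!catA perm_cat2l perm_catC.
- suff H : M *m (G *m (\matrix_i R (b i))^T) = M.
    have : G *m (\matrix_i R (b i))^T = 1%:M.
      by rewrite -(mulKmx uM (G *m _)) H mulVmx.
    by move/mulmx1_unit; case.
  apply/matrixP=> i j; rewrite {1}MR !mxE.
  have := congr1 (fun B : 'M[E]_1 => B 0 0) (RGR (a i) (b j)); rewrite [RHS]mxE eqxx mulr1n => <-.
  rewrite -mulmxA [RHS]mxE; apply: eq_bigr => l _; rewrite !mxE; congr (_ * _).
  by apply: eq_bigr => n _; rewrite !mxE.
- move=> i; apply: (@cycM _ _ _) => w; apply: (can_inj (@trmxK _ _ _)); apply: (@cycM _ _ _) => w'.
  rewrite !mulmxA RX !trmx_mul !trmxK GT !mulmxA RX.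
  rewrite !RGR; congr (_%:M); apply: permP.
  by rewrite -!cats1 -!catA perm_cat2l perm_catC.
- exists K => w Kw; apply: (@cycM _ _ _) => w'; rewrite RW mulmx0; apply/rowP=> j; rewrite !mxE.
  by apply: nilP; apply: leq_trans Kw _; rewrite !size_cat addnAC leq_addl.
- by move=> y H; apply: (cyc _) => w; rewrite -[R w]/(R ([::] ++ w)) -RW.
- by move=> w; rewrite RW RGR mxE eqxx cats0 mulr1n.
Qed.

End Functionals.

(** * Pairs of commuting nilpotent matrices with a cyclic vector *)

Section NilpotentPair.
Variables (E : fieldType) (r : nat) (X Y : 'M[E]_r) (v : 'rV[E]_r).
Implicit Types (h : nat -> 'rV[E]_r) (d : nat -> nat) (c : nat -> nat -> E).

(** An element of the [E[X]]-module generated by the [h i]; under [blk_free] and [blk_nil] this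
    module is the direct sum of the cyclic modules [E[X]/(X^(d i))]. *)
Definition blk n h d c : 'rV[E]_r :=
  \sum_(i < n) \sum_(a < d i) c i a *: (h i *m X ^+ a).

Definition blk_free n h d :=
  forall c, blk n h d c = 0 -> forall i a, (i < n)%N -> (a < d i)%N -> c i a = 0.

Definition blk_nil n h d := forall i, (i < n)%N -> h i *m X ^+ d i = 0.

Lemma mulmxXD x a b : x *m X ^+ (a + b) = x *m X ^+ a *m X ^+ b :> 'rV[E]_r.
Proof. by rewrite exprD -mulmxE mulmxA. Qed.

Lemma blk_ext n h d c c' :
  (forall i a, (i < n)%N -> (a < d i)%N -> c i a = c' i a) -> blk n h d c = blk n h d c'.
Proof. by move=> H; apply: eq_bigr => i _; apply: eq_bigr => a _; rewrite H. Qed.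

Lemma blkD n h d c c' :
  blk n h d c + blk n h d c' = blk n h d (fun i a => c i a + c' i a).
Proof.
rewrite /blk -big_split /=; apply: eq_bigr => i _; rewrite -big_split /=.
by apply: eq_bigr => a _; rewrite scalerDl.
Qed.

Lemma blkZ n h d c k : k *: blk n h d c = blk n h d (fun i a => k * c i a).
Proof.
rewrite /blk scaler_sumr; apply: eq_bigr => i _; rewrite scaler_sumr.
by apply: eq_bigr => a _; rewrite scalerA.
Qed.

Lemma blk0 n h d : blk n h d (fun _ _ => 0) = 0.
Proof. by rewrite /blk big1 // => i _; rewrite big1 // => a _; rewrite scale0r. Qed.

Definition shift e c i b := if (e <= b)%N then c i (b - e)%N else 0.

Lemma blkX n h d c e : blk_nil n h d ->
  blk n h d c *m X ^+ e = blk n h d (shift e c).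
Proof.
move=> nh; rewrite mulmx_suml; apply: eq_bigr => i _; rewrite mulmx_suml.
have dX a : (d i <= a)%N -> h i *m X ^+ a = 0.
  by move=> /subnKC <-; rewrite mulmxXD nh // mul0mx.
under eq_bigr => a _ do rewrite -scalemxAl -mulmxXD.
have [ed|de] := leqP e (d i); last first.
  rewrite big1 => [|a _]; last by rewrite dX ?scaler0 // (leq_trans (ltnW de)) // leq_addl.
  rewrite big1 // => a _; rewrite /shift leqNgt (ltn_trans (ltn_ord a) de) scale0r //.
rewrite -(big_mkord xpredT (fun a => c i a *: (h i *m X ^+ (a + e)))).
rewrite -(big_mkord xpredT (fun a => shift e c i a *: (h i *m X ^+ a))).
rewrite [RHS](big_cat_nat _ ed) //= [X in _ = X + _]big_nat [X in _ = X + _]big1 ?add0r; last first.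
  by move=> a /andP[_ ae]; rewrite /shift leqNgt ae scale0r.
rewrite [LHS](@big_cat_nat _ _ _ (d i - e)) ?leq_subr //= [X in _ + X = _]big_nat.
rewrite [X in _ + X = _]big1 ?addr0; last first.
  by move=> a /andP[ae _]; rewrite dX ?scaler0 // addnC -leq_subLR.
rewrite -[X in _ = \sum_(X <= _ < _) _]add0n big_addn; apply: eq_bigr => a _.
by rewrite /shift leq_addl addnK.
Qed.

Lemma blk_extend n h d x k c :
  blk n.+1 (fun i => if i == n then x else h i) (fun i => if i == n then k else d i) c =
  blk n h d c + \sum_(a < k) c n a *: (x *m X ^+ a).
Proof.
rewrite /blk big_ord_recr /= eqxx; congr (_ + _); apply: eq_bigr => i _.
by rewrite ltn_eqF.
Qed.

(** Only the socle [x X^(k-1)] of the new block has to be tested: in a relation, a power of [X]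
    lifts the lowest term [X^b] of that block to [X^(k-1)] and kills its other terms. *)
Lemma blk_free_extend n h d x k :
  blk_free n h d -> blk_nil n h d -> x *m X ^+ k = 0 ->
  (forall c, x *m X ^+ k.-1 <> blk n h d c) ->
  blk_free n.+1 (fun i => if i == n then x else h i) (fun i => if i == n then k else d i).
Proof.
move=> fh nh xk Nx c; rewrite blk_extend => c0.
have cn a : (a < k)%N -> c n a = 0.
  move=> ak; apply: contrapT => /eqP ca.
  have exa : exists a, (a < k)%N && (c n a != 0) by exists a; rewrite ak.
  case: (ex_minnP exa) => b /andP[bk cb] minb {a ak ca exa}.
  apply: (Nx (fun i a => - (c n b)^-1 * shift (k.-1 - b) c i a)).
  rewrite -blkZ -blkX //; move: c0 => /eqP; rewrite addr_eq0 => /eqP ->.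
  rewrite mulNmx scaleNr scalerN opprK mulmx_suml (bigD1 (Ordinal bk)) //= big1.
    rewrite addr0 -scalemxAl scalerA mulVf // scale1r -mulmxXD subnKC //.
    by rewrite -ltnS prednK // (leq_ltn_trans _ bk).
  move=> a /eqP ab; have [lab|lba|eab] := ltngtP a b; last by case: ab; apply: val_inj.
    case: (eqVneq (c n a) 0) => [->|ca]; first by rewrite scale0r mul0mx.
    by have := minb a; rewrite ltn_ord ca leqNgt lab => /(_ isT).
  rewrite -scalemxAl -mulmxXD.
  have : (k <= a + (k.-1 - b))%N by lia.
  by move/subnKC <-; rewrite mulmxXD xk mul0mx scaler0.
move=> i a; rewrite ltnS leq_eqVlt; case: eqP => [->|/eqP Ni] /=; first by move=> _; apply: cn.
move=> lin ad; apply: fh => //; move: c0; rewrite [X in _ + X]big1 ?addr0 //.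
by move=> b _; rewrite cn ?scale0r.
Qed.

Lemma blk_free_size n h d : blk_free n h d -> (\sum_(i < n) d i <= r)%N.
Proof.
move=> fh; pose T := {i : 'I_n & 'I_(d i)}.
have -> : (\sum_(i < n) d i = #|{: T}|)%N.
  by rewrite card_tagged sumnE big_map big_enum /=; apply: eq_bigr => i _; rewrite card_ord.
pose M : 'M[E]_(#|{: T}|, r) :=
  \matrix_(t < #|{: T}|) (h (tag (enum_val t)) *m X ^+ (tagged (enum_val t))).
suff : row_free M by move/eqP <-; apply: rank_leq_col.
apply: inj_row_free => x xM.
pose c i a := if insub i is Some i' then
  if (insub a : option 'I_(d (val (i' : 'I_n)))) is Some a' then
    x 0 (enum_rank (Tagged (fun i : 'I_n => 'I_(d i)) a')) else 0 else 0.
have c0 : blk n h d c = 0.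
  rewrite -[RHS]xM mulmx_sum_row /blk sig_big_dep /=.
  rewrite (reindex (@enum_val _ {: T})) /=; last first.
    by exists enum_rank => t _; [apply: enum_valK | apply: enum_rankK].
  apply: eq_bigr => t _; rewrite rowK; congr (_ *: _).
  rewrite /c valK valK.
  congr (x _ _); rewrite -[RHS](@enum_valK {: T} t); congr enum_rank.
  by case: (@enum_val {: T} _ t).
apply/rowP=> t; rewrite mxE -(@enum_valK {: T} t); case: (@enum_val {: T} _ t) => i a.
by have := fh _ c0 i a (ltn_ord i) (ltn_ord a); rewrite /c !valK.
Qed.

Lemma blk_eq0 n h d c :
  (forall i a, (i < n)%N -> (a < d i)%N -> c i a = 0) -> blk n h d c = 0.
Proof. by move=> c0; rewrite -(blk0 n h d); apply: blk_ext. Qed.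

(* Only [l - q] coefficients per block of the quotient survive; this is the parameter count behind
   [st_size] below. *)
Lemma blk_div n h d c q l : blk_free n h d -> blk_nil n h d ->
  (forall i, (i < n)%N -> (l <= d i)%N) -> (q <= l)%N ->
  blk n h d c *m X ^+ (l - q) = 0 ->
  exists2 c', blk n h d c = blk n h d c' *m X ^+ q &
    forall i b, (i < n)%N -> c' i b != 0 ->
      exists2 t, (t < l - q)%N & b = (d i - l + t)%N.
Proof.
move=> fh nh ld ql; rewrite blkX // => /fh c0.
have cz i a : (i < n)%N -> (a + (l - q) < d i)%N -> c i a = 0.
  move=> lin ad; have := c0 i (a + (l - q))%N lin ad.
  by rewrite /shift leq_addl addnK.
exists (fun i b => if (b + q < d i)%N then c i (b + q)%N else 0).
  rewrite blkX //; apply: blk_ext => i a lin ad; rewrite /shift.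
  case: (leqP q a) => [qa|aq]; first by rewrite subnK // ad.
  by apply: cz => //; have := ld i lin; lia.
move=> i b lin; case: ifP => [bq|]; last by rewrite eqxx.
move=> cn; have := contraNN (fun H => introT eqP (cz i (b + q)%N lin H)) cn.
by have := ld i lin => dl H; exists (b - (d i - l))%N; lia.
Qed.

Hypothesis XY : X *m Y = Y *m X.

Lemma XYcomm (x : 'rV[E]_r) a : x *m X ^+ a *m Y = x *m Y *m X ^+ a.
Proof.
rewrite -!mulmxA; congr (_ *m _); rewrite !mulmxE.
by apply/esym/commrX; rewrite /GRing.comm -!mulmxE XY.
Qed.

(* [h i] is monic of degree [i] in [Y] over [E[X]] and killed by [X ^+ d i], and the [h i *m X ^+ a]
   with [a < d i] are independent; [u] lists the structure constants of [Y] found so far. *)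
Record stage n h d (u : seq E) : Prop := Stage {
  st0 : h 0 = v;
  st_pos : forall i, (i <= n)%N -> (0 < d i)%N;
  st_mono : forall i, (i <= n)%N -> (d n <= d i <= d 0)%N;
  st_nil : blk_nil n.+1 h d;
  st_free : blk_free n.+1 h d;
  st_Y : forall i, (i < n)%N ->
    exists2 c, (forall a b, c a b \in acl u) & h i *m Y = blk n.+1 h d c;
  st_first : d n = d 0 -> forall i, (i <= n)%N -> h i = v *m Y ^+ i;
  st_size : (size u + n.+1 * d n + (d n < d 0) <= \sum_(i < n.+1) d i)%N }.

(** Let [q] be least such that [h n Y X^q] falls into the module built so far; [blk_div] gives [g]
    in that module such that [x = h n Y - g] has [x X^q = 0]. If [q > 0], then [x] opens a new
    block; if [q = 0], the module is stable under [Y]. In [st_size], the [n.+1 * (d n - q)]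
    coefficients of [g] are paid for by the fall of [n.+1 * d n], and a new block adds [q] to both
    sides. The boolean records the parameter saved at the first drop; it makes the final count
    strict. *)
Lemma stage_step n h d u : (exists q, Y ^+ q = 0) -> stage n h d u ->
  (exists h' d' u', stage n.+1 h' d' u') \/
  (exists u' c, [/\ {subset u <= u'}, (size u' < \sum_(i < n.+1) d i)%N,
     forall a b, c a b \in acl u' & h n *m Y = blk n.+1 h d c]).
Proof.
move=> [N YN] [h0 dpos mono nh fh hY first sz].
have exq : exists q, `[< exists c, h n *m Y *m X ^+ q = blk n.+1 h d c >].
  exists (d n); apply/asboolP; exists (fun _ _ => 0).
  by rewrite blk0 -XYcomm nh ?mul0mx.
case: (ex_minnP exq) => q /asboolP[c0 c0E] minq.
have qd : (q <= d n)%N.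
  apply: minq; apply/asboolP; exists (fun _ _ => 0).
  by rewrite blk0 -XYcomm nh ?mul0mx.
have [||c cE cnz] := @blk_div n.+1 h d c0 q (d n) fh nh _ qd.
- by move=> i /mono/andP[].
- by rewrite -c0E -mulmxXD subnKC // -XYcomm nh ?mul0mx.
pose g := blk n.+1 h d c; pose x := h n *m Y - g.
have xq : x *m X ^+ q = 0 by rewrite mulmxBl c0E cE subrr.
pose e := (d n - q)%N.
pose L := [seq c i (d i - d n + t)%N | i <- iota 0 n.+1, t <- iota 0 e].
have cL i b : (i < n.+1)%N -> c i b != 0 -> c i b \in L.
  move=> lin /(cnz _ _ lin)[t te ->]; apply/allpairsP; exists (i, t).
  by split=> //; rewrite mem_iota add0n.
have sL : size L = (n.+1 * e)%N by rewrite size_allpairs !size_iota.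
(* When the orders [d i] drop for the first time, nilpotency of [Y] saves one parameter: on the top
     power of [X], the matrix [Y] is the companion matrix of a polynomial with constant term [c 0 0]. *)
have [L' [subL sL']] : exists L', {subset L <= 0 :: L'} /\
    (size L' + ((d n == d 0) && (0 < e)) = n.+1 * e)%N.
  case: (boolP ((d n == d 0) && (0 < e)%N)) => [/andP[/eqP dn0 e0]|_]; last first.
    by exists L; rewrite sL addn0; split=> // y yL; rewrite inE yL orbT.
  exists (behead L); split; last first.
    by rewrite size_behead sL addn1 prednK // muln_gt0.
  suff L0 : head 0 L = 0.
    by case: (L) L0 => //= y s -> z; rewrite !inE.
  have -> : head 0 L = c 0%N 0%N.
    rewrite /L; case: (e) e0 => // e' _ /=.
    by rewrite dn0 subnn.
  have hE := first dn0.
  have dE i : (i <= n)%N -> d i = d 0 by move=> /mono; rewrite dn0 -eqn_leq => /eqP.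
  pose D := (d 0).-1; pose xi := v *m X ^+ D.
  have d0 := dpos 0 (leq0n _).
  have xi0 : xi != 0.
    apply/eqP => xi0; pose f i a : E := ((i == 0%N) && (a == D))%:R.
    have f0 : blk n.+1 h d f = 0.
      rewrite /blk big_ord_recl [X in _ + X]big1 ?addr0; last first.
        by move=> i _; rewrite big1 // => a _; rewrite scale0r.
      rewrite big1 // => a _; rewrite h0 /f /=.
      by case: (_ =P D) => [->|_]; rewrite ?scale0r //= -/xi xi0 scaler0.
    have Dd : (D < d 0)%N by rewrite /D prednK.
    by have := fh f f0 0%N D isT Dd; rewrite /f !eqxx => /eqP; rewrite oner_eq0.
  have rel : xi *m Y ^+ n.+1 = \sum_(i < n.+1) c i 0%N *: (xi *m Y ^+ i).
    have xD : x *m X ^+ D = 0.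
      have -> : D = (q + (D - q))%N by rewrite subnKC // /D; lia.
      by rewrite mulmxXD xq mul0mx.
    move: xD; rewrite mulmxBl => /subr0_eq; rewrite /g blkX //.
    have comXY (y : 'rV_r) a b : y *m X ^+ a *m Y ^+ b = y *m Y ^+ b *m X ^+ a.
      elim: b => [|b IH]; first by rewrite !expr0 !mulmx1.
      by rewrite exprSr -!mulmxE !mulmxA IH XYcomm.
    have <- : h n *m Y *m X ^+ D = xi *m Y ^+ n.+1.
      by rewrite hE // /xi comXY exprSr -mulmxE mulmxA.
    move=> ->; apply: eq_bigr => i _.
    have din : d i = D.+1 by rewrite prednK // dE // -ltnS.
    rewrite din big_ord_recr /= big1 ?add0r; last first.
      by move=> a _; rewrite /shift leqNgt ltn_ord scale0r.
    by rewrite /shift leqnn subnn hE -1?ltnS // comXY.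
  have exp : exists p, xi *m Y ^+ p == 0 by exists N; rewrite YN mulmx0.
  case: (ex_minnP exp) => -[|p]; first by rewrite expr0 mulmx1 (negPf xi0).
  move=> /eqP xip minp.
  have xiS s : (p < s)%N -> xi *m Y ^+ s = 0.
    by move/subnKC => <-; rewrite exprD -mulmxE mulmxA xip mul0mx.
  (* Here [p] is the last exponent with [xi Y^p] nonzero, so multiplying [rel] by [Y^p] leaves only
     the term of index 0. *)
  have : c 0%N 0%N *: (xi *m Y ^+ p) = 0.
    transitivity (xi *m Y ^+ n.+1 *m Y ^+ p).
      rewrite rel mulmx_suml big_ord_recl big1 ?addr0 /=; last first.
        by move=> i _; rewrite -scalemxAl -mulmxA mulmxE -exprD xiS ?scaler0 // addSn ltnS leq_addl.
      by rewrite expr0 mulmx1 scalemxAl.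
    by rewrite -mulmxA mulmxE -exprD xiS // addSn ltnS leq_addl.
  move/eqP; rewrite scaler_eq0 => /orP[/eqP//|/minp]; by rewrite ltnn.
pose u' := u ++ L'.
have uu' : {subset u <= u'} by move=> y yu; rewrite mem_cat yu.
have cu' i b : (i < n.+1)%N -> c i b \in acl u'.
  move=> lin; have [->|/(cL i b lin)/subL] := eqVneq (c i b) 0; first exact: rpred0.
  rewrite inE => /orP[/eqP->|cb]; first exact: rpred0.
  by apply: mem_acl; rewrite mem_cat cb orbT.
have su : (size u' + n.+1 * q + (q < d 0) <= \sum_(i < n.+1) d i)%N.
  have /andP[_ dd0] := mono n (leqnn n).
  have eE : (n.+1 * e = n.+1 * d n - n.+1 * q)%N by rewrite mulnBr.
  have le2 : (n.+1 * q <= n.+1 * d n)%N by rewrite leq_mul2l qd orbT.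
  rewrite /u' size_cat; move: sz sL'; rewrite eE.
  case: (ltnP (d n) (d 0)) => dd.
    by rewrite ltn_eqF //= (leq_ltn_trans qd dd); lia.
  have -> : d n == d 0 by rewrite eqn_leq dd0 dd.
  have -> : (q < d 0)%N = (0 < e)%N.
    by rewrite /e subn_gt0 (_ : d n = d 0) //; apply/eqP; rewrite eqn_leq dd0 dd.
  by case: (0 < e)%N => /=; lia.
have [q0|q0] := posnP q.
  right; exists u', (fun i a => if (i < n.+1)%N then c i a else 0); split=> //.
  - by move: su; rewrite q0 muln0 addn0 (dpos 0 (leq0n _)) addn1.
  - by move=> a b; case: ifP => [/cu'//|_]; apply: rpred0.
  - move: c0E; rewrite cE q0 expr0 !mulmx1 => ->; apply: blk_ext => i a lin _.
    by rewrite lin.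
left; exists (fun i => if i == n.+1 then x else h i), (fun i => if i == n.+1 then q else d i), u'.
have extE w f : blk n.+1 h d f = w -> w = blk n.+2 (fun i => if i == n.+1 then x else h i)
    (fun i => if i == n.+1 then q else d i) (fun i a => if (i < n.+1)%N then f i a else 0).
  move=> <-; rewrite blk_extend [X in _ + X]big1 ?addr0 => [|a _]; last by rewrite ltnn scale0r.
  by apply: blk_ext => i a lin _; rewrite lin.
split=> /=.
- by [].
- by move=> i; rewrite leq_eqVlt ltnS; case: eqP => //= _; apply: dpos.
- move=> i; rewrite eqxx leq_eqVlt ltnS.
  have /andP[_ dd0] := mono n (leqnn n).
  case: eqP => /= [_|_ /mono/andP[dn ->]]; first by rewrite leqnn (leq_trans qd).
  by rewrite (leq_trans qd).
- by move=> i; rewrite ltnS leq_eqVlt; case: eqP => //= _; apply: nh.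
- apply: blk_free_extend => // f fE.
  have /minq : `[< exists c, h n *m Y *m X ^+ q.-1 = blk n.+1 h d c >].
    apply/asboolP; exists (fun i a => f i a + shift q.-1 c i a).
    by rewrite -blkD -blkX // -fE -mulmxDl subrK.
  by rewrite leqNgt prednK // leqnn.
- move=> i lin; rewrite (ltn_eqF lin); move: lin; rewrite ltnS leq_eqVlt => /orP[/eqP->|lin].
    exists (fun i a => (if (i < n.+1)%N then c i a else 0) + ((i == n.+1) && (a == 0%N))%:R).
      move=> a b; apply: rpredD; last by rewrite rpred_nat.
      by case: ifP => [/cu'//|_]; apply: rpred0.
    rewrite -blkD -(extE _ _ erefl) blk_extend -/g blk_eq0 ?add0r; last first.
      by move=> i0 a li0 _; rewrite ltn_eqF.
    rewrite (bigD1 (Ordinal q0)) //= big1 ?addr0; last first.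
      by move=> a a0; rewrite (_ : (a == 0 :> nat) = false) ?andbF ?scale0r //; apply: negbTE.
    by rewrite !eqxx scale1r expr0 mulmx1 addrC subrK.
  have [f fu ->] := hY i lin.
  exists (fun i a => if (i < n.+1)%N then f i a else 0); last exact: extE.
  by move=> a b; case: ifP => _; [apply: acl_sub (fu a b) | apply: rpred0].
- rewrite eqxx => q0'; have /andP[_ dd0] := mono n (leqnn n).
  have qn : q = d n by apply/eqP; rewrite eqn_leq qd q0'.
  move=> i; rewrite leq_eqVlt ltnS; case: eqP => [-> _|_ lin]; last by apply: first; rewrite -?qn.
  rewrite /x (_ : g = 0) ?subr0; first by rewrite first -?qn // exprSr -mulmxE mulmxA.
  apply: blk_eq0 => i0 a li0 _; apply: contrapT => /eqP/(cnz _ _ li0)[t].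
  by rewrite qn subnn.
- rewrite eqxx big_ord_recr /= eqxx; under eq_bigr => i _ do rewrite ltn_eqF //.
  suff : (size u' + n.+2 * q + (q < d 0) <= \sum_(i < n.+1) d i + q)%N by [].
  by move: su; rewrite [(n.+2 * q)%N]mulSn; lia.
Qed.


Lemma stage0 : v != 0 -> (exists q, X ^+ q = 0) -> exists h d, stage 0 h d [::].
Proof.
move=> v0 [N XN].
have exq : exists q, v *m X ^+ q == 0 by exists N; rewrite XN mulmx0.
case: (ex_minnP exq) => q /eqP vq minq.
have q0 : (0 < q)%N by rewrite lt0n; apply: contraNneq v0 => q0; rewrite -vq q0 expr0 mulmx1.
exists (fun i => if i == 0%N then v else 0), (fun i => if i == 0%N then q else q).
split=> //.
- by move=> i; rewrite leqn0 => /eqP ->.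
- by move=> i; rewrite leqn0 => /eqP ->; rewrite /= leqnn.
- by move=> i; rewrite ltnS leqn0 => /eqP ->.
- apply: (@blk_free_extend 0 (fun _ => 0) (fun _ => q)) => // c.
  rewrite /blk big_ord0 => /eqP/minq; by rewrite leqNgt prednK // leqnn.
- by move=> _ i; rewrite leqn0 => /eqP ->; rewrite /= expr0 mulmx1.
- by rewrite big_ord1 /= ltnn addn0 mul1n.
Qed.

(** The stages stop because nonempty independent blocks number at most [r]. At the end, the span of
    the blocks over [acl u'] (the predicate [Lam]) contains [v] and is stable under [X] and [Y]. So
    fewer than [r] structure constants, together with the values of [g] on at most [r] basis
    vectors, suffice. *)
Lemma pair_trdeg (g : 'cV[E]_r) : v != 0 -> (exists q, X ^+ q = 0) -> (exists q, Y ^+ q = 0) ->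
  exists2 u : seq E, (size u < r + r)%N &
    forall a b, (v *m X ^+ a *m Y ^+ b *m g) 0 0 \in acl u.
Proof.
move=> v0 nX nY.
suff H k n h d u : stage n h d u -> (r <= n + k)%N ->
    exists2 u : seq E, (size u < r + r)%N &
      forall a b, (v *m X ^+ a *m Y ^+ b *m g) 0 0 \in acl u.
  by have [h [d]] := stage0 v0 nX; move/(H r 0%N); apply.
elim: k n h d u => [|k IH] n h d u st rk.
  have := blk_free_size (st_free st); suff : (n.+1 <= \sum_(i < n.+1) d i)%N by lia.
  rewrite -[X in (X <= _)%N]card_ord -sum1_card leq_sum // => i _.
  by rewrite (st_pos st) // -ltnS.
have [[h' [d' [u' st']]]|] := stage_step nY st; first by apply: IH st' _; rewrite addSnnS.
move=> [u' [c [uu' su' cu' hY]]].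
pose L := [seq (h i *m X ^+ a *m g) 0 0 | i <- iota 0 n.+1, a <- iota 0 (d i)].
have sL : size L = (\sum_(i < n.+1) d i)%N.
  rewrite size_allpairs_dep sumnE !big_map -[iota 0 n.+1]/(index_iota 0 n.+1) big_mkord.
  by apply: eq_bigr => i _; rewrite size_iota.
have dr := blk_free_size (st_free st).
exists (u' ++ L); first by rewrite size_cat sL -addSn leq_add // (leq_trans su').
pose Lam x := exists2 c, (forall a b, c a b \in acl u') & x = blk n.+1 h d c.
have Lam0 : Lam 0 by exists (fun _ _ => 0); [move=> *; apply: rpred0 | rewrite blk0].
have LamD x y : Lam x -> Lam y -> Lam (x + y).
  move=> [c1 c1u ->] [c2 c2u ->]; rewrite blkD; exists (fun i a => c1 i a + c2 i a) => // a b.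
  by apply: rpredD.
have LamZ k0 x : k0 \in acl u' -> Lam x -> Lam (k0 *: x).
  move=> ku [c1 c1u ->]; rewrite blkZ; exists (fun i a => k0 * c1 i a) => // a b.
  by apply: rpredM.
have LamX a x : Lam x -> Lam (x *m X ^+ a).
  move=> [c1 c1u ->]; rewrite blkX; last exact: st_nil st.
  by exists (shift a c1) => // i b; rewrite /shift; case: ifP => _; rewrite ?rpred0.
have LamS (I : Type) (s : seq I) F : (forall i, Lam (F i)) -> Lam (\sum_(i <- s) F i).
  by move=> HF; elim/big_rec: _ => // i x _; apply: LamD.
have LamhY i : (i <= n)%N -> Lam (h i *m Y).
  rewrite leq_eqVlt => /orP[/eqP->|lin]; first by exists c.
  have [c1 c1u ->] := st_Y st lin; exists c1 => // a b; apply: acl_sub (c1u a b).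
  exact: uu'.
have LamY x : Lam x -> Lam (x *m Y).
  move=> [c1 c1u ->]; rewrite /blk mulmx_suml; apply: (LamS _ _ _) => i.
  rewrite mulmx_suml; apply: (LamS _ _ _) => a; rewrite -scalemxAl; apply: (LamZ _ _ _ _) => //.
  by rewrite XYcomm; apply: LamX; apply: LamhY; rewrite -ltnS.
have Lamv : Lam v.
  exists (fun i a => ((i == 0%N) && (a == 0%N))%:R); first by move=> a b; apply: rpred_nat.
  rewrite /blk big_ord_recl [X in _ + X]big1 ?addr0; last first.
    by move=> i _; rewrite big1 // => a _; rewrite scale0r.
  rewrite (bigD1 (Ordinal (st_pos st (leq0n n)))) //= scale1r expr0 mulmx1 (st0 st).
  rewrite big1 ?addr0 // => a a0.
  by rewrite (_ : (a == 0 :> nat) = false) ?scale0r //; apply: negbTE.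
have LamXY a b : Lam (v *m X ^+ a *m Y ^+ b).
  elim: b => [|b IHb]; first by rewrite expr0 mulmx1; apply: LamX.
  by rewrite exprSr -mulmxE mulmxA; apply: LamY.
move=> a b; have [c1 c1u ->] := LamXY a b.
rewrite /blk mulmx_suml summxE rpred_sum // => i _.
rewrite mulmx_suml summxE rpred_sum // => l _.
rewrite -scalemxAl mxE rpredM //.
  by apply: acl_sub (c1u i l) => y yu; rewrite mem_cat yu.
apply: mem_acl; rewrite mem_cat; apply/orP; right; apply/allpairsPdep; exists (i : nat), (l : nat).
by rewrite !mem_iota !add0n !ltn_ord.
Qed.

End NilpotentPair.

Lemma cyclic_trdeg (E : fieldType) r (X : 'M[E]_r) (v : 'rV_r) (g : 'cV[E]_r) :
  (exists q, X ^+ q = 0) ->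
  exists2 u : seq E, (size u <= r)%N & forall a, (v *m X ^+ a *m g) 0 0 \in acl u.
Proof.
move=> nX; have [v0|v0] := eqVneq v 0.
  by exists [::] => // a; rewrite v0 !mul0mx mxE rpred0.
have [h [d [h0 _ _ nh fh _ _ _]]] := stage0 X v0 nX.
have := blk_free_size fh; rewrite big_ord1 => dr.
exists [seq (v *m X ^+ a *m g) 0 0 | a <- iota 0 (d 0)]; first by rewrite size_map size_iota.
move=> a; have [ad|da] := ltnP a (d 0).
  by apply: mem_acl; apply/mapP; exists a; rewrite ?mem_iota.
by rewrite -(subnKC da) mulmxXD -h0 nh // !mul0mx mxE rpred0.
Qed.

(** * Local Gorenstein algebras *)

Section RowSelection.
Variables (E : fieldType) (r : nat).

Lemma row_free_col_mx a (B : 'M[E]_(a, r)) (x : 'rV_r) :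
  row_free B -> ~~ (x <= B)%MS -> row_free (col_mx B x).
Proof.
move=> fB Nx; apply: inj_row_free => u.
rewrite -[u]hsubmxK mul_row_col.
set u1 := lsubmx u; set u2 := rsubmx u => e.
have u20 : u2 = 0.
  apply: contraNeq Nx => u2n; rewrite [u2]mx11_scalar in e u2n.
  have c0 : u2 0 0 != 0 by apply: contraNneq u2n => ->; rewrite raddf0.
  move: e; rewrite mul_scalar_mx => /eqP; rewrite addr_eq0 => /eqP e.
  have -> : x = - (u2 0 0)^-1 *: (u1 *m B).
    by rewrite e scalerN scaleNr opprK scalerA mulVf ?scale1r.
  by rewrite scalemx_sub // submxMl.
move: e; rewrite u20 mul0mx addr0 => e.
by have -> : u1 = 0; [apply: (row_free_inj fB); rewrite e mul0mx | rewrite row_mx0].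
Qed.

Lemma select_rows (T : Type) (P : T -> Prop) (R : T -> 'rV[E]_r) a (A : 'M[E]_(a, r)) :
  row_free A -> exists s (t : 'I_s -> T), [/\ forall i, P (t i),
    row_free (col_mx A (\matrix_i R (t i))) &
    forall x, P x -> (R x <= col_mx A (\matrix_i R (t i)))%MS].
Proof.
move=> fA; pose Q s := exists t : 'I_s -> T,
  (forall i, P (t i)) /\ row_free (col_mx A (\matrix_i R (t i))).
have Q0 : exists s, `[< Q s >].
  have t0 : 'I_0 -> T by case.
  exists 0%N; apply/asboolP; exists t0; split; first by case.
  rewrite /row_free eqn_leq rank_leq_row /=; apply: (@leq_trans (\rank A)).
    by rewrite (eqP fA) addn0.
  by rewrite mxrankS // -addsmxE addsmxSl.
have Qr s : `[< Q s >] -> (s <= r)%N.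
  move=> /asboolP[t [_ /eqP ft]]; apply: leq_trans (leq_addl a s) _.
  by rewrite -ft rank_leq_col.
case: (ex_maxnP Q0 Qr) => s /asboolP[t [Pt ft]] maxs; exists s, t; split=> // x Px.
apply: contrapT => /negP Nx; suff /asboolP/maxs : Q s.+1 by rewrite ltnn.
exists (fun i => if unlift ord0 i is Some j then t j else x); split.
  by move=> i; case: unliftP.
have := row_free_col_mx ft Nx; rewrite /row_free => /eqP rk.
rewrite eqn_leq rank_leq_row /= [X in (X <= _)%N]addnS -[X in (X <= _)%N]addn1 -{1}rk mxrankS //.
rewrite col_mx_sub -[col_mx A _]/(col_mx A (\matrix_i R (t i))) col_mx_sub -!addsmxE.
apply/andP; split; last first.
  apply: submx_trans (addsmxSr _ _).
  have -> : R x = row ord0 (\matrix_i R (if unlift ord0 i is Some j then t j else x)).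
    by rewrite rowK unlift_none.
  exact: row_sub.
rewrite addsmxSl /=; apply: submx_trans (addsmxSr _ _); apply/row_subP => i.
have -> : row i (\matrix_i R (t i)) =
    row (lift ord0 i) (\matrix_i R (if unlift ord0 i is Some j then t j else x)).
  by rewrite !rowK liftK.
exact: row_sub.
Qed.

Lemma mxOver_det n (K : subringClosed E) (A : 'M[E]_n) : A \is a mxOver K -> \det A \in K.
Proof.
move=> /mxOverP KA; rewrite rpred_sum // => s _; rewrite rpredM ?rpred_sign //.
by rewrite rpred_prod.
Qed.

Lemma mxOver_invmx n (K : divringClosed E) (A : 'M[E]_n) :
  A \is a mxOver K -> invmx A \is a mxOver K.
Proof.
move=> KA; rewrite /invmx; case: ifP => // _; apply/mxOverP=> i j.
rewrite !mxE rpredM ?rpredV ?mxOver_det // rpredM ?rpred_sign //.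
by apply: mxOver_det; apply/mxOverP=> k l; rewrite !mxE (mxOverP KA).
Qed.

End RowSelection.

Section Gorenstein.
Variables (E : fieldType) (m r : nat) (phi : seq 'I_m -> E).
Variables (X : 'I_m -> 'M[E]_r) (G : 'M[E]_r) (v : 'rV[E]_r).
Hypothesis gor : gorenstein phi X G v.

Let R w := v *m wordmx X w.

Lemma wordmx_comm i w : X i *m wordmx X w = wordmx X w *m X i.
Proof.
elim: w => [|j w IH] /=; first by rewrite mulmx1 mul1mx.
by rewrite mulmxA (gor_comm gor) -!mulmxA IH.
Qed.

Lemma wordmx_adj w : wordmx X w *m G = G *m (wordmx X w)^T.
Proof.
elim: w => [|i w IH] /=; first by rewrite trmx1 mulmx1 mul1mx.
by rewrite -mulmxA IH mulmxA (gor_adj gor) -mulmxA -trmx_mul -wordmx_comm.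
Qed.

Lemma wordmx_catC w w' : wordmx X (w ++ w') = wordmx X (w' ++ w).
Proof.
elim: w => [|i w IH] /=; first by rewrite cats0.
by rewrite IH !wordmx_cat /= [RHS]mulmxA -wordmx_comm mulmxA.
Qed.

Lemma wordmx_perm w w' : perm_eq w w' -> wordmx X w = wordmx X w'.
Proof.
move=> pw; apply: (catCA_perm_ind _ pw (P := fun s => wordmx X w = wordmx X s)) => // s1 s2 s3 ->.
by rewrite !catA !(wordmx_cat _ _ s3) wordmx_catC.
Qed.

Lemma gor_pair w w' : R w *m G *m (R w')^T = (phi (w ++ w'))%:M.
Proof.
rewrite trmx_mul mulmxA -(mulmxA _ G) -wordmx_adj mulmxA -(mulmxA v) -wordmx_cat.
by rewrite [LHS]mx11_scalar -(gor_phi gor).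
Qed.

Lemma gor_cyc_mx n (A B : 'M[E]_(r, n)) : (forall w, R w *m A = R w *m B) -> A = B.
Proof.
move=> H; apply/matrixP=> i j; have : col j (A - B) = 0.
  by apply: (gor_cyc gor) => w; rewrite colE mulmxA mulmxBr [_ *m A]H subrr mul0mx.
by move/matrixP/(_ i 0); rewrite !mxE => /subr0_eq.
Qed.

Lemma gor_nondeg (x : 'rV_r) : (forall w, x *m G *m (R w)^T = 0) -> x = 0.
Proof.
move=> H; have : G *m x^T = 0.
  apply: gor_cyc_mx => w; rewrite mulmx0; apply: trmx_inj.
  by rewrite trmx0 trmx_mul [(G *m _)^T]trmx_mul trmxK (gor_sym gor) H.
move/(congr1 (mulmx (invmx G))); rewrite mulmx0 mulKmx ?(gor_unit gor) //.
by move/(congr1 trmx); rewrite trmxK trmx0.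
Qed.

(* [s] spans the socle and is dual to the unit [v] *)
Lemma gor_socle : v != 0 -> exists s w0 k, [/\ s = k *: R w0,
  forall w, R w != 0 -> (size w <= size w0)%N &
  forall w, s *m G *m (R w)^T = (w == [::])%:R%:M].
Proof.
move=> v0; have [K nK] := gor_nil gor.
pose Q n := exists2 w, size w = n & R w != 0.
have Q0 : exists n, `[< Q n >].
  by exists 0%N; apply/asboolP; exists [::]; rewrite // /R mulmx1.
have QK n : `[< Q n >] -> (n <= K)%N.
  move=> /asboolP[w <- Rw]; rewrite leqNgt; apply: contra Rw => /ltnW/nK.
  by rewrite /R => ->; rewrite mulmx0.
case: (ex_maxnP Q0 QK) => n /asboolP[w0 sw0 Rw0] maxn.
have RX i : R w0 *m X i = 0.
  apply: contrapT => /eqP H; suff /asboolP/maxn : Q n.+1 by rewrite ltnn.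
  exists (rcons w0 i); first by rewrite size_rcons sw0.
  by rewrite -cats1 /R wordmx_cat wordmx1 mulmxA.
have RG i w : R w0 *m G *m (R (i :: w))^T = 0.
  rewrite gor_pair -[phi _](_ : (R (w0 ++ i :: w) *m G *m v^T) 0 0 = _); last by rewrite -(gor_phi gor).
  by rewrite /R wordmx_cat /= !mulmxA -/(R w0) RX !mul0mx mxE raddf0.
have p0 : phi w0 != 0.
  apply: contra Rw0 => /eqP p0; apply/eqP; apply: gor_nondeg => -[|i w]; last exact: RG.
  by rewrite gor_pair cats0 p0 raddf0.
exists ((phi w0)^-1 *: R w0), w0, (phi w0)^-1; split=> [//|w Rw|[|i w]].
- by rewrite sw0; apply: maxn; apply/asboolP; exists w.
- by rewrite -!scalemxAl gor_pair cats0 scale_scalar_mx mulVf.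
- by rewrite -!scalemxAl RG scaler0 raddf0.
Qed.

Lemma gor_select (P : seq 'I_m -> Prop) : exists s (t : 'I_s -> seq 'I_m),
  [/\ forall i, P (t i), row_free (\matrix_i R (t i)) &
    forall w, P w -> (R w <= \matrix_i R (t i))%MS].
Proof.
have f0 : row_free (0 : 'M[E]_(0, r)) by rewrite /row_free mxrank0.
have [s [t [Pt ft st]]] := select_rows P R f0; exists s, t.
have eqA : (col_mx (0 : 'M[E]_(0, r)) (\matrix_i R (t i)) :=: \matrix_i R (t i))%MS.
  by apply: eqmx_trans (eqmx_sym (addsmxE _ _)) _; apply: adds0mx.
split=> // [|w Pw]; last by rewrite -eqA st.
by move: ft; rewrite /row_free eqA.
Qed.

(** The letters [f j] span the maximal ideal modulo its square, hence generate the algebra. Any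
    other letter is traded for letters [f j] and for words of length at least 2; the latter lengthen
    the whole word, which by nilpotency can happen only finitely often (the induction on [q]). *)
Lemma nakayama n (f : 'I_n -> 'I_m) s (t : 'I_s -> seq 'I_m) :
  (forall i, (1 < size (t i))%N) ->
  (forall i, (R [:: i] <= col_mx (\matrix_i R (t i)) (\matrix_j R [:: f j]))%MS) ->
  forall y : 'cV_r, (forall w, R (map f w) *m y = 0) -> y = 0.
Proof.
move=> st Rf y Hy; have [K nK] := gor_nil gor.
apply: (gor_cyc gor) => w; rewrite -/(R w).
suff H q u w' : (K <= size u + size w' + q)%N -> R (map f u ++ w') *m y = 0.
  by apply: (H K [::]); rewrite leq_addl.
elim: q u w' => [|q IHq] u w' Kq.
  by rewrite /R nK ?mulmx0 ?mul0mx // size_cat size_map -[X in (_ <= X)%N]addn0.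
elim: w' u Kq => [|i w' IH] u Kq; first by rewrite cats0.
pose Z := wordmx X (map f u ++ w') *m y.
have RZ w1 : R (map f u ++ w1 ++ w') *m y = R w1 *m Z.
  rewrite /R /Z -!mulmxA; congr (_ *m _); rewrite mulmxA -wordmx_cat; congr (_ *m _).
  by rewrite !wordmx_cat !mulmxA -(wordmx_cat _ w1) wordmx_catC wordmx_cat.
rewrite -[i :: w']/([:: i] ++ w') RZ; have /submxP[D ->] := Rf i; rewrite -mulmxA.
suff -> : col_mx (\matrix_i R (t i)) (\matrix_j R [:: f j]) *m Z = 0 by rewrite mulmx0.
rewrite mul_col_mx; suff [-> ->] : \matrix_i R (t i) *m Z = 0 /\ \matrix_j R [:: f j] *m Z = 0.
  by rewrite col_mx0.
split; apply/row_matrixP => j; rewrite row_mul rowK row0 -RZ.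
  by apply: IHq; apply: leq_trans Kq _; rewrite size_cat /=; have := st j; lia.
rewrite catA -[_ ++ [:: f j]]/(map f u ++ map f [:: j]) -map_cat; apply: IH.
by apply: leq_trans Kq _; rewrite size_cat /=; lia.
Qed.



(** Take a basis [M] of the algebra made of the unit and of nonempty words in the letters [f j]. The
    Gram matrix of [M] and the operators of these letters are expressed by values of [phi] on words
    in them, hence by [u]. An operator is recovered from the coordinates of its letter, so each of
    the other [m - n] letters costs its coordinates, one of which is zero. *)
Lemma gor_extend n (f : 'I_n -> 'I_m) (u : seq E) : injective f -> v != 0 ->
  (forall y : 'cV_r, (forall w, R (map f w) *m y = 0) -> y = 0) ->
  (forall w, phi (map f w) \in acl u) ->
  exists2 u' : seq E, (size u' <= size u + (m - n) * r.-1)%N & forall w, phi w \in acl u'.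
Proof.
move=> injf v0 cycf phiu; have [s0 [w0 [k0 [_ _ sG]]]] := gor_socle v0.
have fv : row_free v by rewrite -row_leq_rank lt0n mxrank_eq0.
have [s [t [Pt ft st]]] := select_rows (fun w => w <> [::]) (fun w => R (map f w)) fv.
set M := col_mx v _ in ft st.
have fullM : row_full M.
  rewrite -cokermx_eq0; apply/eqP/matrixP=> i j; rewrite mxE.
  have : col j (cokermx M) = 0; last by move/matrixP/(_ i 0); rewrite !mxE.
  have M0 : M *m col j (cokermx M) = 0 by rewrite colE mulmxA mulmx_coker mul0mx.
  apply: cycf => -[|a w].
    move: M0; rewrite mul_col_mx => /(congr1 usubmx); rewrite col_mxKu raddf0 => M0.
    by rewrite /R mulmx1.
  have /submxP[D ->] : (R (map f (a :: w)) <= M)%MS by apply: st.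
  by rewrite -mulmxA M0 mulmx0.
have rE : r = (1 + s)%N by rewrite -(eqP ft); apply/esym/eqP.
have [tau tauE] : exists tau : 'I_(1 + s) -> seq 'I_n, forall a, row a M = R (map f (tau a)).
  exists (fun a => if fintype.split a is inr b then t b else [::]) => a.
  case: (split_ordP a) => b ->.
    by rewrite rowKu ord1 row_id /R mulmx1.
  by rewrite rowKd rowK.
have [M' MM'] : exists M', M' *m M = 1%:M by apply/row_fullP.
have [M2 MM2] : exists M2, M *m M2 = 1%:M by apply/row_freeP.
have M2E : M2 = M' by rewrite -[M']mulmx1 -MM2 mulmxA MM' mul1mx.
rewrite {M2}M2E in MM2.
pose c i := R [:: i] *m M'.
pose J := [seq i <- enum 'I_m | i \notin codom f].
pose L := [seq c i 0 (rshift 1 a) | i <- J, a <- enum 'I_s].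
have sJ : size J = (m - n)%N.
  have := count_predC (mem (codom f)) (enum 'I_m); rewrite size_enum_ord.
  rewrite -!size_filter -[size [seq x <- enum _ | predC _ x]]/(size J).
  suff -> : size [seq x <- enum 'I_m | mem (codom f) x] = n by lia.
  transitivity #|codom f|; last by rewrite card_codom ?card_ord.
  by rewrite cardE enumT; congr size; apply: eq_filter => i; rewrite !inE.
exists (u ++ L).
  rewrite size_cat leq_add2l size_allpairs sJ size_enum_ord leq_mul2l.
  by rewrite [X in X.-1]rE add1n leqnn orbT.
set K := acl (u ++ L).
have uK : {subset acl u <= K} by apply: acl_sub => x xu; rewrite mem_cat xu.
have HK : M *m G *m M^T \is a mxOver K.
  apply/mxOverP=> a b; have -> : (M *m G *m M^T) a b = phi (map f (tau a ++ tau b)).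
    rewrite map_cat; have /(congr1 (fun A : 'M[E]_1 => A 0 0)) := gor_pair (map f (tau a)) (map f (tau b)).
    rewrite -!tauE tr_row -!row_mul mxE [in RHS]mxE eqxx mulr1n => <-.
    rewrite !mxE; apply: eq_bigr => i _; rewrite !mxE.
    by congr (_ * _); apply: eq_bigr => l _; rewrite !mxE.
  exact/uK/phiu.
have uH : M *m G *m M^T \in unitmx.
  suff : (M *m G *m M^T) *m (M'^T *m invmx G *m M') = 1%:M by case/mulmx1_unit.
  rewrite !mulmxA -[_ *m M^T *m _]mulmxA -trmx_mul MM' trmx1 mulmx1.
  by rewrite mulmxK ?(gor_unit gor).
have XJK i : M *m X (f i) *m M' \is a mxOver K.
  suff -> : M *m X (f i) *m M' = (M *m X (f i) *m G *m M^T) *m invmx (M *m G *m M^T).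
    apply: mxOverM; last exact: mxOver_invmx.
    apply/mxOverP=> a b.
    have -> : (M *m X (f i) *m G *m M^T) a b = phi (map f ((tau a ++ [:: i]) ++ tau b)).
      rewrite map_cat.
      have /(congr1 (fun A : 'M[E]_1 => A 0 0)) := gor_pair (map f (tau a ++ [:: i])) (map f (tau b)).
      rewrite [in LHS]map_cat {1}/R wordmx_cat wordmx1 mulmxA -/(R _).
      rewrite -!tauE tr_row -!row_mul mxE [in RHS]mxE eqxx mulr1n => <-.
      rewrite !mxE; apply: eq_bigr => l _; rewrite !mxE.
      by congr (_ * _); apply: eq_bigr => q _; rewrite !mxE.
    exact/uK/phiu.
  apply: (canRL (mulmxK uH)); rewrite !mulmxA -[_ *m M' *m M]mulmxA MM' mulmx1.
  by [].
have WJK w : M *m wordmx X (map f w) *m M' \is a mxOver K.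
  elim: w => [|i w IH] /=; first by rewrite mulmx1 MM2 mxOver_scalar ?rpred0 ?rpred1.
  have -> : M *m (X (f i) *m wordmx X (map f w)) *m M' =
    (M *m X (f i) *m M') *m (M *m wordmx X (map f w) *m M').
    by rewrite !mulmxA -[_ *m M' *m M]mulmxA MM' mulmx1.
  exact: mxOverM.
have v0E : v *m M' = row 0 1%:M.
  rewrite -MM2 row_mul; congr (_ *m _); apply/rowP=> l; rewrite mxE.
  have -> : (0 : 'I_(1 + s)) = lshift s (0 : 'I_1) by apply: val_inj.
  exact/esym/col_mxEu.
have cK i : c i \is a mxOver K.
  have [/codomP[j ->]|Nj] := boolP (i \in codom f).
    have -> : c (f j) = row 0 1%:M *m (M *m X (f j) *m M').
      by rewrite -v0E !mulmxA -[_ *m M' *m M]mulmxA MM' mulmx1 /c /R wordmx1.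
    by apply: mxOverM => //; apply/mxOverP=> a b; rewrite !mxE rpred_nat.
  apply/mxOverP=> a b; rewrite ord1; case: (split_ordP b) => b' ->; last first.
    apply: mem_acl; rewrite mem_cat; apply/orP; right; apply/allpairsP; exists (i, b').
    by rewrite mem_filter Nj !mem_enum.
  (* The coordinate along the unit is the pairing with the socle element [s0], which kills every
     nonempty word. *)
  suff -> : c i 0 (lshift s b') = 0 by apply: rpred0.
  have := sG [:: i]; rewrite [RHS]raddf0.
  have -> : R [:: i] = c i *m M by rewrite -mulmxA MM' mulmx1.
  rewrite trmx_mul mulmxA.
  have -> : s0 *m G *m M^T = row_mx 1%:M 0.
    rewrite /M tr_col_mx mul_mx_row; congr row_mx.
      by have := sG [::]; rewrite /R mulmx1.
    apply/matrixP=> z a'; rewrite mxE [RHS]mxE.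
    have := congr1 (fun A : 'M[E]_1 => A z 0) (sG (map f (t a'))).
    have -> : (map f (t a') == [::]) = false by have := Pt a'; case: (t a').
    rewrite raddf0 mxE [RHS]mxE => e; rewrite -[RHS]e; apply: eq_bigr => l _; rewrite !mxE.
    by congr (_ * _); apply: eq_bigr => q _.
  rewrite -[c i]hsubmxK tr_row_mx mul_row_col mul1mx mul0mx addr0 row_mxEl.
  by move/(congr1 (fun A : 'M[E]_1 => A b' 0)); rewrite [LHS]mxE [RHS]mxE.
have XK i : M *m X i *m M' \is a mxOver K.
  apply/mxOverP=> a b.
  have -> : (M *m X i *m M') a b = (row a (M *m X i *m M')) 0 b by rewrite [RHS]mxE.
  rewrite !row_mul tauE.
  have -> : R (map f (tau a)) *m X i *m M' = c i *m (M *m wordmx X (map f (tau a)) *m M').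
    rewrite !mulmxA -[c i *m M]mulmxA MM' mulmx1 /R wordmx1.
    by rewrite -(mulmxA v (X i)) wordmx_comm mulmxA.
  exact: (mxOverP (mxOverM (cK i) (WJK _))).
move=> w.
have WK w' : M *m wordmx X w' *m M' \is a mxOver K.
  elim: w' => [|i w' IH] /=; first by rewrite mulmx1 MM2 mxOver_scalar ?rpred0 ?rpred1.
  have -> : M *m (X i *m wordmx X w') *m M' =
    (M *m X i *m M') *m (M *m wordmx X w' *m M').
    by rewrite !mulmxA -[_ *m M' *m M]mulmxA MM' mulmx1.
  exact: mxOverM.
rewrite (gor_phi gor).
have -> : v *m wordmx X w *m G *m v^T =
    row 0 1%:M *m (M *m wordmx X w *m M') *m (M *m G *m M^T) *m (row 0 1%:M)^T.
  rewrite -v0E trmx_mul !mulmxA -[v *m M' *m M]mulmxA MM' mulmx1.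
  rewrite -[_ *m M' *m M]mulmxA MM' mulmx1 -!mulmxA; do 3! congr (_ *m _).
  by rewrite mulmxA -trmx_mul MM' trmx1 mul1mx.
have row0K : row 0 (1%:M : 'M[E]_(1 + s)) \is a mxOver K.
  by apply/mxOverP=> a b; rewrite !mxE rpred_nat.
apply: (mxOverP _ 0 0); do ! apply: mxOverM => //.
by apply/mxOverP=> a b; rewrite !mxE rpred_nat.
Qed.



Let B (x y : 'rV[E]_r) := (x *m G *m y^T) 0 0.

Lemma gor_BC x y : B x y = B y x.
Proof.
rewrite /B -[in LHS](trmxK (x *m G *m y^T)) [LHS]mxE.
by rewrite !trmx_mul trmxK (gor_sym gor) mulmxA.
Qed.

Lemma gor_BBl x x' y : B (x - x') y = B x y - B x' y.
Proof. by rewrite /B !mulmxBl !mxE. Qed.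

Lemma gor_BZl k x y : B (k *: x) y = k * B x y.
Proof. by rewrite /B -!scalemxAl mxE. Qed.

Lemma gor_BR w w' : B (R w) (R w') = phi (w ++ w').
Proof. by rewrite /B gor_pair mxE eqxx. Qed.

(** The functional dual to the [d]-th divided power of the linear form with coefficients [c]. *)
Definition deg_part d (c : 'I_m -> E) w : E := if size w == d then \prod_(i <- w) c i else 0.

Lemma deg_part_perm d c w w' : perm_eq w w' -> deg_part d c w = deg_part d c w'.
Proof. by move=> pw; rewrite /deg_part (perm_size pw) (perm_big _ pw). Qed.

Lemma deg_part2_cat c w w' : deg_part 2 c (w ++ w') =
  deg_part 1 c w * deg_part 1 c w' + deg_part 0 c w * deg_part 2 c w' +
  deg_part 2 c w * deg_part 0 c w'.
Proof.
rewrite /deg_part size_cat big_cat /=.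
case: w => [|i [|j [|k w]]]; case: w' => [|i' [|j' [|k' w']]] //=;
  by rewrite ?addnS ?big_nil ?mul1r ?mulr1 ?mul0r ?mulr0 ?addr0 ?add0r.
Qed.

(* Splitting off a square: for [z] in the annihilator of the square of the maximal ideal with
   [z ^ 2 <> 0], the algebra is a connected sum with the algebra of one quadratic form. *)
Lemma gor_split_square z : v != 0 -> (exists2 w, (1 < size w)%N & R w != 0) ->
  (forall w, (1 < size w)%N -> z *m G *m (R w)^T = 0) -> B z z != 0 ->
  exists c, lowrank r.-1 (fun w => phi w - (B z z)^-1 * deg_part 2 c w).
Proof.
move=> v0 [w2 sw2 Rw2] zR zz; have [s0 [w0 [k0 [s0E maxw sG]]]] := gor_socle v0.
have sw0 : (1 < size w0)%N by apply: leq_trans sw2 (maxw _ Rw2).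
have Bs w : B s0 (R w) = (w == [::])%:R by rewrite /B sG mxE eqxx mulr1n.
have Bss : B s0 s0 = 0 by rewrite {2}s0E gor_BC gor_BZl gor_BC Bs; case: (w0) sw0 => //= *; rewrite mulr0.
have Bzs : B z s0 = 0 by rewrite s0E gor_BC gor_BZl gor_BC /B zR // mxE mulr0.
have R0 : R [::] = v by rewrite /R mulmx1.
(* The socle correction makes [z'] orthogonal to the unit without changing its pairing with nonempty
   words; so [z'] pairs nontrivially with single letters only. *)
pose z' := z - B z v *: s0; pose c i := B z (R [:: i]); pose l := (B z z)^-1.
have Bz'R w : B z' (R w) = deg_part 1 c w.
  rewrite gor_BBl gor_BZl Bs /deg_part; case: w => [|i [|j w]] /=.
  - by rewrite mulr1 R0 subrr.
  - by rewrite mulr0 subr0 big_seq1.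
  - by rewrite mulr0 subr0 /B zR // mxE.
have Bz's : B z' s0 = 0 by rewrite gor_BBl gor_BZl Bzs Bss mulr0 subr0.
have Bz'z' : B z' z' = B z z.
  by rewrite {2}/z' gor_BC gor_BBl gor_BZl [B s0 _]gor_BC Bz's mulr0 subr0 gor_BC gor_BBl gor_BZl
     [B s0 _]gor_BC Bzs mulr0 subr0.
clearbody z'.
(* The multiple of [z'] projects [R w] to the hyperplane orthogonal to [z']. The socle term matches
   the two outer terms of [deg_part2_cat], so the Gram matrix of the [R' w] is the Hankel matrix of
   the new functional. Any [r] vectors of a hyperplane are dependent, so its minors of size [r]
   vanish. *)
pose R' w := R w - ((l * deg_part 1 c w) *: z' - (- (l * deg_part 2 c w)) *: s0).
exists c; split.
- move=> w w' pw; rewrite (deg_part_perm _ _ pw) !(gor_phi gor); congr (_ - _).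
  by rewrite (wordmx_perm pw).
- have [K nK] := gor_nil gor; exists (maxn K 3) => w.
  rewrite geq_max => /andP[Kw w3]; rewrite (gor_phi gor) nK // mulmx0 !mul0mx mxE /deg_part.
  by rewrite gtn_eqF // mulr0 subr0.
have R'R' w w' : B (R' w) (R' w') = phi (w ++ w') - l * deg_part 2 c (w ++ w').
  rewrite /R' gor_BBl [B (R w) _]gor_BC gor_BBl gor_BR.
  rewrite !(gor_BBl, gor_BZl) [B z' (_ - _)]gor_BC [B s0 (_ - _)]gor_BC !(gor_BBl, gor_BZl).
  rewrite !Bz'R !Bs ![B (R _) _]gor_BC !Bz'R !Bs ![B s0 z']gor_BC Bz's Bss Bz'z'.
  rewrite deg_part2_cat; have -> : phi (w' ++ w) = phi (w ++ w').
    by rewrite !(gor_phi gor) wordmx_catC.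
  have dz u : (u == [::])%:R = deg_part 0 c u :> E.
    by rewrite /deg_part; case: u => //=; rewrite big_nil.
  have l0 : l != 0 by rewrite invr_neq0.
  rewrite !dz (_ : B z z = l^-1); last by rewrite invrK.
  by move: (l) l0 => k k_neq0; field.
have R'z w : B (R' w) z' = 0.
  rewrite /R' gor_BBl [B (R w) _]gor_BC Bz'R gor_BBl !gor_BZl Bz'z' [B s0 _]gor_BC Bz's.
  by rewrite mulr0 subr0 mulrAC mulVf // mul1r subrr.
have z'0 : z' != 0.
  by apply: contraNneq zz => z'0; rewrite -Bz'z' z'0 /B !mul0mx mxE.
have r0 : (0 < r)%N.
  by case: (r) v v0 => // u; rewrite thinmx0 eqxx.
suff H s (a b : 'I_s -> seq 'I_m) : s = r ->
   \det (hankel (fun w => phi w - l * deg_part 2 c w) a b) = 0.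
  by move=> a b; apply: H; rewrite prednK.
move=> sr; subst s.
have -> : hankel (fun w => phi w - l * deg_part 2 c w) a b =
    (\matrix_i R' (a i)) *m G *m (\matrix_i R' (b i))^T.
  apply/matrixP=> i j; rewrite mxE -R'R' /B !mxE; apply: eq_bigr => q _; rewrite !mxE.
  by congr (_ * _); apply: eq_bigr => p _; rewrite !mxE.
rewrite !det_mulmx; suff -> : \det (\matrix_i R' (a i)) = 0 by rewrite !mul0r.
apply/eqP/negPn/negP => D0; move/eqP: z'0; apply.
have uA : \matrix_i R' (a i) \in unitmx by rewrite unitmxE unitfE.
have : (\matrix_i R' (a i)) *m (G *m z'^T) = 0.
  apply/row_matrixP=> i; rewrite row_mul rowK row0 mulmxA; apply/matrixP=> p q.
  by rewrite !ord1 [RHS]mxE; apply: R'z.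
move/(congr1 (mulmx (invmx (\matrix_i R' (a i))))); rewrite mulKmx // mulmx0.
move/(congr1 (mulmx (invmx G))); rewrite mulKmx ?(gor_unit gor) // mulmx0.
by move/(congr1 trmx); rewrite trmxK trmx0.
Qed.

End Gorenstein.

(** * When the annihilator of the square of the maximal ideal is isotropic *)

Section IsotropicCase.
Variables (E : fieldType) (m r : nat) (phi : seq 'I_m -> E).
Variables (X : 'I_m -> 'M[E]_r) (G : 'M[E]_r) (v : 'rV[E]_r).
Hypothesis gor : gorenstein phi X G v.

(** The orthogonal [U] of the row space of [M] has dimension [r - s] and, by polarization, is
    totally isotropic; hence [2 (r - s) <= r]. Moreover [U] then lies in the row space of [M] and in
    the radical of the form restricted there, which leaves rank at most [s - (r - s)]. *)
Lemma gor_isotropic s (M : 'M[E]_(s, r)) : row_free M ->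
  (forall z : 'rV_r, z *m G *m M^T = 0 -> z *m G *m z^T = 0) -> (2%:R : E) != 0 ->
  (r <= s + s)%N /\ (\rank (M *m G *m M^T) <= s + s - r)%N.
Proof.
move=> fM iso two0.
have GT := gor_sym gor; have uG := gor_unit gor.
pose U := kermx (G *m M^T).
have UM : U *m G *m M^T = 0 by rewrite -mulmxA mulmx_ker.
have rGM : \rank (G *m M^T) = s.
  rewrite -mxrank_tr trmx_mul trmxK GT mxrankMfree ?row_free_unit //.
  exact/eqP.
have rU : \rank U = (r - s)%N by rewrite mxrank_ker rGM.
have sr : (s <= r)%N by rewrite -(eqP fM) rank_leq_col.
have isoU (z z' : 'rV_r) : (z <= U)%MS -> (z' <= U)%MS -> z *m G *m z'^T = 0.
  move=> /submxP[D ->] /submxP[D' ->].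
  have H (x : 'rV_r) : (x *m U) *m G *m (x *m U)^T = 0.
    apply: iso; have -> : x *m U *m G *m M^T = x *m (U *m G *m M^T) by rewrite !mulmxA.
    by rewrite UM mulmx0.
  have := H (D + D'); rewrite !mulmxDl linearD /= !mulmxDr H H add0r addr0.
  set a := D *m U *m G *m _; have -> : D' *m U *m G *m (D *m U)^T = a.
    have tr1 (A : 'M[E]_1) : A^T = A by apply/matrixP=> i j; rewrite mxE !ord1.
    by rewrite -[LHS]tr1 trmx_mul trmxK [(_ *m G)^T]trmx_mul GT mulmxA.
  rewrite -mulr2n -scaler_nat => /eqP; rewrite scaler_eq0 (negPf two0) /= => /eqP //.
have UGU : U *m G *m U^T = 0.
  apply/matrixP=> i j; have := congr1 (fun A : 'M[E]_1 => A 0 0) (isoU _ _ (row_sub i U) (row_sub j U)).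
  rewrite [RHS]mxE => e; rewrite [RHS]mxE -[RHS]e -!row_mul tr_row !mxE.
  by apply: eq_bigr => l _; rewrite !mxE.
have rsum : (\rank U + \rank (G *m U^T) <= r)%N.
  by apply: mulmx0_rank_max; rewrite mulmxA.
have rGU : \rank (G *m U^T) = (r - s)%N.
  by rewrite -mxrank_tr trmx_mul trmxK GT mxrankMfree ?row_free_unit.
have rss : (r <= s + s)%N by move: rsum; rewrite rU rGU; lia.
have MGU : M *m (G *m U^T) = 0.
  by rewrite mulmxA; apply: trmx_inj; rewrite !trmx_mul !trmxK GT mulmxA UM trmx0.
(* [U] lies in the row space of [M], being contained in [U ^ perp] which is that row space *)
have UsubM : (U <= M)%MS.
  have MK : (M <= kermx (G *m U^T))%MS by apply/sub_kermxP.
  have UK : (U <= kermx (G *m U^T))%MS by apply/sub_kermxP; rewrite mulmxA.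
  apply: submx_trans UK _; rewrite -(geq_leqif (mxrank_leqif_sup MK)).
  by rewrite mxrank_ker rGU (eqP fM) subKn.
have [D UD] := submxP UsubM.
have DH : D *m (M *m G *m M^T) = 0 by rewrite !mulmxA -UD UM.
have rD : (r - s <= \rank D)%N by rewrite -rU UD mxrankM_maxl.
have rH := leq_trans (leq_add rD (leqnn _)) (mulmx0_rank_max DH).
by split=> //; move: rH; lia.
Qed.

End IsotropicCase.

(** * Cubics and quartics in three variables *)

Section ThreeLetters.
Variables (E : fieldType) (psi : seq 'I_3 -> E).
Hypothesis psi_perm : forall w w', perm_eq w w' -> psi w = psi w'.

(** Sorted words represent monomials. They are written over [nat] so that their number, the binomial
    coefficient of 6 over 3, is obtained by computation. *)
Definition sorted_words3 : seq (seq nat) :=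
  [seq w <- [::] :: [seq [:: a] | a <- iota 0 3] ++
     [seq [:: a; b] | a <- iota 0 3, b <- iota 0 3] ++
     [seq [:: a; b.1; b.2] | a <- iota 0 3, b <- [seq (b, c) | b <- iota 0 3, c <- iota 0 3]]
  | sorted leq w].

Definition short_values := [seq psi (map inord w) | w <- sorted_words3].

Lemma size_short_values : size short_values = 20.
Proof. by rewrite size_map. Qed.

Lemma mem_short_values w : (size w <= 3)%N -> psi w \in short_values.
Proof.
move=> sw; pose le (i j : 'I_3) := (i <= j)%N.
have le_tot : total le by move=> i j; apply: leq_total.
rewrite -(@psi_perm (sort le w)); last by rewrite perm_sort.
have : sorted le (sort le w) by apply: sort_sorted.
have : (size (sort le w) <= 3)%N by rewrite size_sort.
move: (sort le w) => {sw}w sw ow; apply/mapP; exists (map val w); last first.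
  by rewrite -map_comp map_id_in // => i _ /=; rewrite inord_val.
rewrite mem_filter sorted_map ow andTb.
have mi (i : 'I_3) : (i : nat) \in iota 0 3 by rewrite mem_iota ltn_ord.
case: w sw {ow} => [|a [|b [|c [|d w]]]] // _.
- by rewrite inE mem_cat; apply/orP; right; apply/orP; left; apply/mapP; exists (a : nat).
- rewrite inE 2!mem_cat; apply/orP; right; apply/or3P; apply: Or32.
  by apply/allpairsPdep; exists (a : nat), (b : nat).
- rewrite inE 2!mem_cat; apply/orP; right; apply/or3P; apply: Or33.
  apply/allpairsPdep; exists (a : nat), (b : nat, c : nat); split=> //.
  by apply/allpairsPdep; exists (b : nat), (c : nat).
Qed.

Lemma cubic_trdeg : (forall w, (3 < size w)%N -> psi w = 0) ->
  exists2 u, (size u <= 20)%N & forall w, psi w \in acl u.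
Proof.
move=> H; exists short_values; first by rewrite size_short_values.
move=> w; have [/mem_short_values/mem_acl //|/H ->] := leqP (size w) 3.
exact: rpred0.
Qed.

(* A quartic form whose catalecticant on quadrics has rank one is a power of a linear form, hence
   it is determined by four of its coefficients. *)
Lemma quartic_trdeg (p q : seq 'I_3 -> E) :
  (exists K, forall w, (K <= size w)%N -> psi w = 0) ->
  (forall a b, (1 < size a)%N -> (1 < size b)%N -> psi (a ++ b) = p a * q b) ->
  exists2 u, (size u <= 23)%N & forall w, psi w \in acl u.
Proof.
move=> [K psiK] pq.
(* Descending induction on the length: split off two letters, [w = a ++ b]. The word [a ++ a] is
   longer than [w], so [p a * q a = 0], while [psi w] equals both [p a * q b] and [p b * q a]. *)
have long w : (4 < size w)%N -> psi w = 0.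
  have [n] := ubnP (K - size w); elim: n w => // n IH w.
  rewrite ltnS => Kn sw; have [/psiK //|wK] := leqP K (size w).
  apply: contrapT => /eqP pw.
  pose a := take (size w - 2) w; pose b := drop (size w - 2) w.
  have wE : w = a ++ b by rewrite cat_take_drop.
  have sa : size a = (size w - 2)%N by rewrite size_takel // leq_subr.
  have sb : size b = 2%N by rewrite size_drop subKn // (leq_trans _ sw).
  have e1 : psi w = p a * q b by rewrite {1}wE pq ?sa ?sb //; lia.
  have e2 : psi w = p b * q a.
    by rewrite (@psi_perm _ (b ++ a)) ?pq ?sa ?sb //; [lia | rewrite {1}wE perm_catC].
  have : psi (a ++ a) = 0 by apply: IH; rewrite size_cat sa; lia.
  rewrite pq ?sa; [|lia|lia] => /eqP; rewrite mulf_eq0 => /orP[/eqP pa|/eqP qa].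
    by move: pw; rewrite e1 pa mul0r eqxx.
  by move: pw; rewrite e2 qa mulr0 eqxx.
have [[w [sw pw]]|none] := pselect (exists w, size w = 4%N /\ psi w != 0); last first.
  have [w|u su Hu] := cubic_trdeg; last by exists u => //; apply: leq_trans su _.
  rewrite leq_eqVlt => /orP[/eqP sw|/long //].
  by apply: contrapT => /eqP pw; apply: none; exists w.
(* If [psi] is nonzero on [jklo], then [p] and [q] are nonzero on [jk], so [psi] is nonzero on
   [jkjk], a permutation of [jjkk] and of [kkjj]; hence [p] and [q] are nonzero on [jj]. *)
have [i pi] : exists i, psi [:: i; i; i; i] != 0.
  case: w sw pw => [|j [|k [|l [|o [|? ?]]]]] // _.
  rewrite -[ [:: _; _; _; _] ]/([:: j; k] ++ [:: l; o]) pq // mulf_eq0 negb_or => /andP[pjk qlo].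
  have qjk : q [:: j; k] != 0.
    apply: contraNneq (mulf_neq0 pjk qlo) => qjk.
    by rewrite -pq // (@psi_perm _ ([:: l; o] ++ [:: j; k])) ?pq ?qjk ?mulr0 // perm_catC.
  have : psi ([:: j; j] ++ [:: k; k]) != 0.
    rewrite (@psi_perm _ ([:: j; k] ++ [:: j; k])) ?pq ?mulf_neq0 //.
    by rewrite /= perm_cons (perm_catCA [:: j] [:: k] [:: k]).
  move=> jk; have := jk; rewrite pq // mulf_eq0 negb_or => /andP[pjj _].
  have := jk; rewrite (@psi_perm _ ([:: k; k] ++ [:: j; j])); last by rewrite perm_catC.
  rewrite pq // mulf_eq0 negb_or => /andP[_ qjj].
  by exists j; rewrite -[ [:: _; _; _; _] ]/([:: j; j] ++ [:: j; j]) pq // mulf_neq0.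
pose u := short_values ++ [seq psi [:: i; i; i; j] | j <- enum 'I_3].
exists u; first by rewrite size_cat size_short_values size_map size_enum_ord.
have u1 j : psi [:: i; i; i; j] \in acl u.
  by apply: mem_acl; rewrite mem_cat map_f ?orbT // mem_enum.
have pqi : p [:: i; i] * q [:: i; i] != 0 by rewrite -pq.
have [pi0 qi0] : p [:: i; i] != 0 /\ q [:: i; i] != 0.
  by move: pqi; rewrite mulf_eq0 negb_or => /andP.
have u2 j k : psi [:: i; i; j; k] \in acl u.
  have -> : psi [:: i; i; j; k] = psi [:: i; i; i; j] * psi [:: i; i; i; k] / psi [:: i; i; i; i].
    apply: (canRL (mulfK pi)).
    have -> : psi [:: i; i; j; k] = p [:: i; j] * q [:: i; k].
      by rewrite -pq //; apply: psi_perm; rewrite /= perm_cons (perm_catCA [:: i] [:: j] [:: k]).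
    have -> : psi [:: i; i; i; i] = p [:: i; i] * q [:: i; i] by rewrite -pq.
    have -> : psi [:: i; i; i; k] = p [:: i; i] * q [:: i; k] by rewrite -pq.
    have -> : psi [:: i; i; i; j] = p [:: i; j] * q [:: i; i].
      by rewrite -pq //; apply: psi_perm; rewrite (perm_catCA [:: i; i] [:: i; j] [::]).
    ring.
  by rewrite rpredM ?rpredV // rpredM.
move=> {w sw pw}w; have [/mem_short_values sw|] := leqP (size w) 3.
  by apply: mem_acl; rewrite mem_cat sw.
rewrite leq_eqVlt => /orP[|/long ->]; last exact: rpred0.
case: w => [|j [|k [|l [|o [|? ?]]]]] // _.
have -> : psi [:: j; k; l; o] = psi [:: i; i; j; k] * psi [:: i; i; l; o] / psi [:: i; i; i; i].
  apply: (canRL (mulfK pi)).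
  have -> : psi [:: j; k; l; o] = p [:: j; k] * q [:: l; o] by rewrite -pq.
  have -> : psi [:: i; i; i; i] = p [:: i; i] * q [:: i; i] by rewrite -pq.
  have -> : psi [:: i; i; l; o] = p [:: i; i] * q [:: l; o] by rewrite -pq.
  have -> : psi [:: i; i; j; k] = p [:: j; k] * q [:: i; i].
    by rewrite -pq //; apply: psi_perm; rewrite (perm_catC [:: i; i]).
  ring.
by rewrite rpredM ?rpredV // rpredM.
Qed.

End ThreeLetters.

(** * Embedding dimension and the bound on parameters *)

Section EmbeddingDimension.
Variables (E : fieldType) (m r : nat) (phi : seq 'I_m -> E).
Variables (X : 'I_m -> 'M[E]_r) (G : 'M[E]_r) (v : 'rV[E]_r).
Hypothesis gor : gorenstein phi X G v.

Lemma wordmx_nseq i q : wordmx X (nseq q i) = X i ^+ q.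
Proof. by elim: q => [|q IH] //=; rewrite IH exprS. Qed.

Lemma gor_expr0 i : exists q, X i ^+ q = 0.
Proof.
by have [K nK] := gor_nil gor; exists K; rewrite -wordmx_nseq nK // size_nseq.
Qed.

Lemma gor_phi_perm w w' : perm_eq w w' -> phi w = phi w'.
Proof. by move=> pw; rewrite !(gor_phi gor) (wordmx_perm gor pw). Qed.

Lemma gor_one_letter (f : 'I_1 -> 'I_m) :
  exists2 u, (size u <= r)%N & forall w, phi (map f w) \in acl u.
Proof.
have [u su Hu] := cyclic_trdeg v (G *m v^T) (gor_expr0 (f 0)).
exists u => // w; rewrite (gor_phi gor); have -> : map f w = nseq (size w) (f 0).
  by elim: w => //= i w ->; rewrite ord1.
by rewrite wordmx_nseq -[_ *m G *m _]mulmxA.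
Qed.

Lemma gor_two_letters (f : 'I_2 -> 'I_m) : v != 0 ->
  exists2 u, (size u < r + r)%N & forall w, phi (map f w) \in acl u.
Proof.
move=> v0.
have [u su Hu] := pair_trdeg (gor_comm gor (f 0) (f 1)) (G *m v^T) v0 (gor_expr0 _) (gor_expr0 _).
exists u => // w.
have pw : perm_eq w (nseq (count_mem 0 w) 0 ++ nseq (count_mem 1 w) 1).
  apply/allP=> i _; apply/eqP; rewrite /= count_cat !count_nseq.
  have : i \in [:: 0; 1].
    by rewrite !inE; case: i => -[|[|n]] //= Hn; rewrite -!val_eqE.
  by rewrite !inE => /orP[/eqP->|/eqP->] /=; rewrite ?eqxx ?mul1n ?mul0n ?addn0.
rewrite (gor_phi_perm (perm_map f pw)) map_cat !map_nseq (gor_phi gor) wordmx_cat !wordmx_nseq.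
by rewrite mulmxA -[_ *m G *m _]mulmxA.
Qed.

(** The words [t] give a basis of the square of the maximal ideal and the letters [f] a basis modulo
    that square, so [n] is the embedding dimension. All of them are orthogonal to the socle element
    [s0], whence [n + s < r]. If the square were zero, every letter would lie in the one-dimensional
    socle, forcing [n <= 1]. *)
Lemma gor_embedding : v != 0 -> exists n s (f : 'I_n -> 'I_m) (t : 'I_s -> seq 'I_m),
  let M := \matrix_i (v *m wordmx X (t i)) in
  [/\ injective f, (n + s < r)%N,
     [/\ forall i, (1 < size (t i))%N, row_free M &
       forall w, (1 < size w)%N -> (v *m wordmx X w <= M)%MS],
     forall y : 'cV_r, (forall w, v *m wordmx X (map f w) *m y = 0) -> y = 0 &
     (1 < n)%N -> exists2 w, (1 < size w)%N & v *m wordmx X w != 0].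
Proof.
move=> v0; have [s [t [Pt ft st]]] := gor_select X v (fun w => 1 < size w)%N.
have [n [f [_ ff sf]]] := select_rows (fun _ => True) (fun i : 'I_m => v *m wordmx X [:: i]) ft.
have [s0 [w0 [k0 [s0E maxw sG]]]] := gor_socle gor v0.
set Mt := \matrix_i _ in ft st ff sf; set Mf := \matrix_i _ in ff sf.
have s0n : s0 != 0.
  apply/eqP => s00; have := sG [::]; rewrite s00 !mul0mx /= => /(congr1 (fun A : 'M[E]_1 => A 0 0)).
  by rewrite !mxE eqxx => /eqP; rewrite eq_sym oner_eq0.
have rowG (w : seq 'I_m) : w != [::] -> v *m wordmx X w *m (G *m s0^T) = 0.
  move=> wn; apply: trmx_inj; rewrite trmx0 trmx_mul [(G *m _)^T]trmx_mul trmxK (gor_sym gor) sG.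
  by rewrite (negPf wn) raddf0.
exists n, s, f, t; split=> //.
- move=> i j fij; apply/eqP; apply: contraT => ij.
  have : delta_mx 0 (rshift s i) - delta_mx 0 (rshift s j) = 0 :> 'rV[E]_(s + n).
    apply: (row_free_inj ff); rewrite mulmxBl -!rowE mul0mx !rowKd !rowK fij subrr //.
  move/matrixP/(_ 0 (rshift s i)); rewrite !mxE !eqxx /= eq_rshift (negPf ij) subr0 => /eqP.
  by rewrite oner_eq0.
- have : col_mx Mt Mf *m (G *m s0^T) = 0.
    rewrite mul_col_mx; suff [-> ->] : Mt *m (G *m s0^T) = 0 /\ Mf *m (G *m s0^T) = 0.
      by rewrite col_mx0.
    split; apply/row_matrixP => i; rewrite row_mul rowK row0 rowG //.
    by rewrite -size_eq0; have := Pt i; case: (size _).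
  move/mulmx0_rank_max; rewrite (eqP ff) -mxrank_tr trmx_mul trmxK (gor_sym gor).
  rewrite mxrankMfree ?row_free_unit ?(gor_unit gor) //.
  by have : (0 < \rank s0)%N; [rewrite lt0n mxrank_eq0 | lia].
- by move=> y; apply: (nakayama gor Pt) => i; apply: sf.
- move=> n1; apply: contrapT => none.
  have R0 w : (1 < size w)%N -> v *m wordmx X w = 0.
    by move=> sw; apply: contrapT => /eqP Rw; apply: none; exists w.
  have Rs i : v *m wordmx X [:: i] = phi [:: i] *: s0.
    apply/eqP; rewrite -subr_eq0; apply/eqP; apply: (gor_nondeg gor) => w.
    rewrite !mulmxBl -!scalemxAl sG (gor_pair gor).
    case: w => [|j w]; first by rewrite cats0 scale_scalar_mx mulr1 subrr.
    by rewrite (gor_phi gor) R0 // !mul0mx mxE !raddf0 addr0.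
  have : (Mf <= s0)%MS by apply/row_subP => i; rewrite rowK Rs scalemx_sub.
  move/mxrankS => /leq_trans /(_ (rank_leq_row _)).
  have : row_free Mf.
    apply: inj_row_free => x xM; have : row_mx 0 x *m col_mx Mt Mf = 0.
      by rewrite mul_row_col xM mul0mx addr0.
    rewrite -(mul0mx _ (col_mx Mt Mf)) => /(row_free_inj ff) /(congr1 rsubmx).
    by rewrite row_mxKr raddf0.
  by move/eqP => ->; rewrite leqNgt n1.
Qed.

End EmbeddingDimension.

(** The counts are [n (r - 1) + 1] for [n <= 2], and [m (r - 2) + 1] plus [m] coefficients when a
    square splits off. Otherwise [r <= 2 s] and [s <= r - 1 - n] give [n = 3] with [r] equal to 8 or
    9, and the form on the square of the maximal ideal has rank at most [2 s - r <= r - 8]. Rank 0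
    gives cubics, with 20 <= 3 * 7 + 1 values; rank at most 1 gives 23 <= 3 * 8 + 1. *)
Lemma lowrank_trdeg (E : numClosedFieldType) m k (phi : seq 'I_m -> E) :
  (0 < m)%N -> (0 < k)%N -> (k <= 9)%N \/ (m <= 2)%N -> lowrank k phi ->
  exists2 u : seq E, (size u <= m * (k - 1) + 1)%N & forall w, phi w \in acl u.
Proof.
move=> m0; have [K] := ubnP k; elim: K k phi => // K IH k phi; rewrite ltnS => kK k0 km lr.
have [r [X [G [v [rk gor]]]]] := lowrank_gorenstein lr.
have [v0|v0] := eqVneq v 0.
  by exists [::] => // w; rewrite (gor_phi gor) v0 !mul0mx mxE rpred0.
have r0 : (0 < r)%N by case: (r) v v0 {gor} => // u; rewrite thinmx0 eqxx.
have le_mr : (m * (r - 1) + 1 <= m * (k - 1) + 1)%N.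
  by rewrite leq_add2r leq_mul2l leq_sub2r ?orbT.
have [n [s [f [t [injf nsr [Pt ft st] cycf nlin]]]]] := gor_embedding gor v0.
have nm : (n <= m)%N by have := leq_card f injf; rewrite !card_ord.
have ext u : (size u <= n * (r - 1) + 1)%N -> (forall w, phi (map f w) \in acl u) ->
    exists2 u : seq E, (size u <= m * (k - 1) + 1)%N & forall w, phi w \in acl u.
  move=> su Hu; have [u' su' Hu'] := gor_extend gor injf v0 cycf Hu; exists u' => //.
  apply: leq_trans su' _; apply: leq_trans le_mr; rewrite -subn1.
  by rewrite -[X in (_ <= X * _ + _)%N](subnKC nm) mulnDl addnAC leq_add2r.
have [n0|n0] := posnP n.
  subst n; apply: (ext [:: phi [::]]) => // -[|[] //].
  by apply: mem_acl; rewrite mem_head.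
have [n1|n1] := eqVneq n 1%N.
  subst n; have [u su Hu] := gor_one_letter gor f; apply: (ext u) => //.
  by rewrite mul1n subnK.
have [n2|n2] := eqVneq n 2%N.
  subst n; have [u su Hu] := gor_two_letters gor f v0; apply: (ext u) => //; lia.
have n3 : (2 < n)%N by lia.
have k9 : (k <= 9)%N by case: km => //; lia.
have [w2 sw2 Rw2] : exists2 w, (1 < size w)%N & v *m wordmx X w != 0 by apply: nlin; lia.
set M := \matrix_i _ in ft st.
have killM (z : 'rV_r) w : z *m G *m M^T = 0 -> (1 < size w)%N -> z *m G *m (v *m wordmx X w)^T = 0.
  by move=> zM sw; have /submxP[D ->] := st w sw; rewrite trmx_mul mulmxA zM mul0mx.
have [hz|iso] := pselect (exists2 z : 'rV_r, z *m G *m M^T = 0 & (z *m G *m z^T) 0 0 != 0).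
  case: hz => z zM zz.
  have [||c lc] := gor_split_square gor v0 _ _ zz; first by exists w2.
    by move=> w sw; apply: killM.
  have [|||u su Hu] := IH r.-1 _ _ _ _ lc; [lia|lia|left; lia|].
  (* The scalar in front of the square is absorbed into the linear form, which then costs exactly
     [m] parameters. *)
  pose l := sqrtC ((z *m G *m z^T) 0 0)^-1.
  exists (u ++ [seq l * c i | i <- enum 'I_m]) => [|w].
    by rewrite size_cat size_map size_enum_ord; move: su le_mr; nia.
  have uw : phi w - l ^+ 2 * deg_part 2 c w \in acl (u ++ [seq l * c i | i <- enum 'I_m]).
    by rewrite sqrtCK; apply: acl_sub (Hu w) => x xu; rewrite mem_cat xu.
  rewrite -[phi w](subrK (l ^+ 2 * deg_part 2 c w)) rpredD // /deg_part.
  case: w {uw} => [|i [|j [|? ?]]] /=; rewrite ?mulr0 ?rpred0 //.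
  have lc' x : l * c x \in acl (u ++ [seq l * c i | i <- enum 'I_m]).
    by apply: mem_acl; rewrite mem_cat; apply/orP; right; apply/mapP; exists x; rewrite ?mem_enum.
  by rewrite !big_cons big_nil mulr1 expr2 mulrACA rpredM.
have {}iso (z : 'rV_r) : z *m G *m M^T = 0 -> z *m G *m z^T = 0.
  move=> zM; apply: contrapT => zz; apply: iso; exists z => //.
  by apply/eqP => z0; apply: zz; rewrite [LHS]mx11_scalar z0 raddf0.
have two0 : (2%:R : E) != 0 by rewrite pnatr_eq0.
have [rs rkM] := gor_isotropic gor ft iso two0.
have nE : n = 3%N by lia.
subst n.
(* Rank at most one means that [phi (a ++ b)] is a product for words of length at least 2; for
   [r = 8] the rank is 0 and the product vanishes. *)
have [p [q [pq pq0]]] : exists p q : seq 'I_m -> E,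
    (forall a b, (1 < size a)%N -> (1 < size b)%N -> phi (a ++ b) = p a * q b) /\
    (r = 8%N -> forall a, p a = 0).
  have [C [D [CD CD0]]] : exists (C : 'cV_s) (D : 'rV_s),
      M *m G *m M^T = C *m D /\ (r = 8%N -> C = 0).
    have [H0|Hn] := eqVneq (\rank (M *m G *m M^T)) 0%N.
      exists 0, 0; rewrite mul0mx; split=> //; apply/eqP; rewrite -mxrank_eq0; exact/eqP.
    have H1 : \rank (M *m G *m M^T) = 1%N.
      by apply/eqP; rewrite eqn_leq lt0n Hn (leq_trans rkM) //; lia.
    have := mulmx_base (M *m G *m M^T); move: (col_base _) (row_base _); rewrite H1 => C D CD.
    by exists C, D; split=> // r8; move: rkM; rewrite H1; lia.
  have coord w : exists x : 'rV_s, (1 < size w)%N -> v *m wordmx X w = x *m M.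
    have [sw|_] := boolP (1 < size w)%N; last by exists 0.
    by have /submxP[x] := st w sw; exists x.
  have [x xE] := choice coord.
  exists (fun a => (x a *m C) 0 0), (fun b => (D *m (x b)^T) 0 0); split; last first.
    by move=> /CD0 -> a; rewrite mulmx0 mxE.
  move=> a b sa sb; have := congr1 (fun A : 'M[E]_1 => A 0 0) (gor_pair gor a b).
  rewrite [RHS]mxE eqxx mulr1n => <-; rewrite !xE // trmx_mul.
  have -> : x a *m M *m G *m (M^T *m (x b)^T) = (x a *m C) *m (D *m (x b)^T).
    by rewrite !mulmxA -(mulmxA _ C D) -CD !mulmxA.
  by rewrite mxE big_ord1.
have permf w w' : perm_eq w w' -> phi (map f w) = phi (map f w').
  by move=> pw; apply: (gor_phi_perm gor); apply: perm_map.
have [r8|r9] : (r = 8 \/ r = 9)%N by lia.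
  have [|u su Hu] := cubic_trdeg permf; last by apply: (ext u) => //; rewrite r8; lia.
  move=> w sw; rewrite -(cat_take_drop 2 w) map_cat pq ?pq0 ?mul0r //;
    by rewrite size_map ?size_drop ?size_takel //; lia.
have [||u su Hu] := @quartic_trdeg _ _ permf (fun w => p (map f w)) (fun w => q (map f w)).
- have [N nN] := gor_nil gor; exists N => w sw.
  by rewrite (gor_phi gor) nN ?size_map // mulmx0 !mul0mx mxE.
- by move=> a b sa sb; rewrite map_cat pq ?size_map.
by apply: (ext u) => //; rewrite r9; lia.
Qed.

(** * Generic linear sections *)

Section GenericSection.
Variables (E : numClosedFieldType) (m k : nat).
Implicit Types phi : seq 'I_m -> E.

Lemma lowrankZ phi x : lowrank k phi -> lowrank k (fun w => x * phi w).
Proof.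
case=> [pp [K nK] mm]; split=> [w w' /pp -> //||a b].
  by exists K => w /nK ->; rewrite mulr0.
have -> : hankel (fun w => x * phi w) a b = x *: hankel phi a b.
  by apply/matrixP=> i j; rewrite !mxE.
by rewrite detZ mm mulr0.
Qed.

(* Only [N] equations with generic coefficients are needed to avoid a cone of dimension [N]:
   rescaling a solution by a transcendental number would raise the transcendence degree. *)
Lemma generic_no_kernel (T : finType) (wd : T -> seq 'I_m) N (L : 'I_N -> T -> E) phi t0 :
  (0 < m)%N -> (0 < k)%N -> (k <= 9)%N \/ (m <= 2)%N -> (m * (k - 1) + 1 <= N)%N ->
  (forall S : seq E, exists x, x \notin acl S) ->
  indep [seq L i t | i <- enum 'I_N, t <- enum T] ->
  lowrank k phi -> phi (wd t0) != 0 ->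
  exists i, \sum_t L i t * phi (wd t) != 0.
Proof.
move=> m0 k0 km kN transc indL lr phi0; apply: contrapT => noi.
have Lphi i : \sum_t L i t * phi (wd t) = 0.
  by apply: contrapT => /eqP Hi; apply: noi; exists i.
have [u0 _ Hu0] := lowrank_trdeg m0 k0 km lr.
set SL := [seq L i t | i <- enum 'I_N, t <- enum T] in indL.
have [x Nx] := transc (SL ++ u0).
have x0 : x != 0 by apply: contraNneq Nx => ->; apply: rpred0.
have [u su Hu] := lowrank_trdeg m0 k0 km (lowrankZ x lr).
pose SL' := [seq L i t | i <- enum 'I_N, t <- [seq t <- enum T | t != t0]].
(* Equation [i] expresses [L i t0] through the other [L i t] and the values of [x * phi]. So
   [1 + N * #|T|] independent elements would depend on at most [N + N * (#|T| - 1)]. *)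
have : (size ((x * phi (wd t0))%R :: SL) <= size (u ++ SL'))%N.
  apply: indep_size => /=.
    split=> //; apply: contra Nx => H.
    have -> : x = x * phi (wd t0) / phi (wd t0) by rewrite mulfK.
    rewrite rpredM ?rpredV //; last first.
      by apply: acl_sub (Hu0 (wd t0)) => y yu; rewrite mem_cat yu orbT.
    by apply: acl_sub H => y yu; rewrite mem_cat yu.
  have Ku w : x * phi w \in acl (u ++ SL').
    by apply: acl_sub (Hu w) => y yu; rewrite mem_cat yu.
  have KL i t : t != t0 -> L i t \in acl (u ++ SL').
    move=> tt0; apply: mem_acl; rewrite mem_cat; apply/orP; right.
    by apply/allpairsP; exists (i, t); rewrite mem_filter tt0 !mem_enum.
  move=> y; rewrite inE => /orP[/eqP->|/allpairsP[[i t] [/= _ _ ->]]]; first exact: Ku.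
  have [->|tt0] := eqVneq t t0; last exact: KL.
  have : \sum_t L i t * (x * phi (wd t)) = 0.
    by under eq_bigr do rewrite mulrCA; rewrite -mulr_sumr Lphi mulr0.
  rewrite (bigD1 t0) //= => /eqP; rewrite addr_eq0 => /eqP Lt0.
  have -> : L i t0 = - (\sum_(t | t != t0) L i t * (x * phi (wd t))) / (x * phi (wd t0)).
    by rewrite -Lt0 mulfK // mulf_neq0.
  by rewrite rpredM ?rpredV // rpredN rpred_sum // => t1 t1n; rewrite rpredM ?KL.
have sSL : size SL = (N * #|T|)%N by rewrite size_allpairs size_enum_ord cardT.
rewrite size_cat size_allpairs /= sSL size_enum_ord.
have -> : size [seq t <- enum T | t != t0] = #|T|.-1.
  by rewrite -rem_filter ?enum_uniq // size_rem ?mem_enum // cardE.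
have : (0 < #|T|)%N by apply/card_gt0P; exists t0.
by move: su; nia.
Qed.

End GenericSection.

(** * Algebraically independent real numbers *)

Section TranscendentalReals.
Variable R : realType.
Let C : numClosedFieldType := R[i].

(** Subtraction and division from 1 and [S] reach the whole generated subfield; codes are taken in a
    countable type of trees, which makes the subfield countable. *)
Fixpoint gen_eval (S : seq C) (t : GenTree.tree nat) : C :=
  match t with
  | GenTree.Leaf n => S`_n
  | GenTree.Node 0 [:: a; b] => gen_eval S a - gen_eval S b
  | GenTree.Node 1 [:: a; b] => gen_eval S a / gen_eval S b
  | _ => 1
  end.

Lemma gen_evalP (S : seq C) x : x \in gen S -> exists t, x = gen_eval S t.
Proof.
move=> /asboolP xS; pose P : {pred C} := [pred x | `[< exists t, x = gen_eval S t >]].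
suff : x \in P by move/asboolP.
apply: xS => [|y].
  split=> [|y z|y z]; first by apply/asboolP; exists (GenTree.Node 2 [::]).
    move=> /asboolP[t ->] /asboolP[t' ->]; apply/asboolP.
    by exists (GenTree.Node 0 [:: t; t']).
  move=> /asboolP[t ->] /asboolP[t' ->]; apply/asboolP.
  by exists (GenTree.Node 1 [:: t; t']).
move=> yS; apply/asboolP; exists (GenTree.Leaf (index y S)).
by rewrite /= nth_index.
Qed.

(** Real numbers algebraic over [S] are roots of countably many nonzero polynomials, hence form a
    countable set, which cannot contain an interval of measure 1. *)
Lemma exists_transcendental (S : seq C) : exists y : R, y%:C \notin acl S.
Proof.
apply: contrapT => none.
pose P (l : seq (GenTree.tree nat)) : {poly C} := Poly (map (gen_eval S) l).
pose A l := [set y : R | P l != 0 /\ root (P l) y%:C]%classic.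
have cA : countable (\bigcup_(l in [set: seq (GenTree.tree nat)]) A l)%classic.
  apply: bigcup_countable => // l _; apply: finite_set_countable.
  have [P0|P0] := eqVneq (P l) 0.
    by rewrite (_ : A l = set0)%classic //; apply/seteqP; split=> y //= []; rewrite P0 eqxx.
  have [s Ps] := closed_field_poly_normal (P l).
  apply: (@sub_finite_set _ _ [set` map (@complex.Re R) s]%classic); last exact: finite_seq.
  move=> y [_ /=]; rewrite Ps rootZ ?lead_coef_eq0 // root_prod_XsubC => ys.
  by apply/mapP; exists y%:C.
have : (`[0, 1] `<=` \bigcup_(l in [set: seq (GenTree.tree nat)]) A l)%classic.
  move=> y _; have : y%:C \in acl S by apply: contrapT => /negP Hy; apply: none; exists y.
  move=> /asboolP[p /polyOverP Kp /andP[p0 py]].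
  have [t tE] := choice (fun i => gen_evalP (Kp i)).
  exists (mkseq t (size p)) => //.
  rewrite /A /=; suff -> : P (mkseq t (size p)) = p by [].
  rewrite /P; apply/polyP=> i; rewrite coef_Poly -map_comp.
  have [ip|pi] := ltnP i (size p); last by rewrite !nth_default ?size_map ?size_iota.
  by rewrite (nth_map 0%N) ?size_iota // nth_iota //= tE.
move=> /subset_card_le/sub_countable/(_ cA)/countable_lebesgue_measure0.
rewrite lebesgue_measure_itv /= lte_fin ltr01 oppr0 adde0 => /eqP.
by rewrite eqe oner_eq0.
Qed.

Lemma exists_indep n : exists s : seq R, size s = n /\ indep (map (fun y => y%:C) s : seq C).
Proof.
elim: n => [|n [s [sn is_]]]; first by exists [::].
have [y Hy] := exists_transcendental (map (fun y => y%:C) s).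
by exists (y :: s); rewrite /= sn.
Qed.

End TranscendentalReals.

(** * Limits of functionals supported at points tending to the origin *)

Section UltraLimits.
Variables (R : realType) (U : set_system nat).
Hypothesis ultraU : UltraFilter U.
Let C : numClosedFieldType := R[i].
Local Open Scope classical_set_scope.

(** An ultrafilter converges to any of its cluster points. A single [U] thus yields limits on all
    words at once, without extracting a diagonal subsequence. *)
Lemma ultra_cvg_real (x : nat -> R) (M : R) : (forall n, `|x n| <= M) -> exists l : R, x @ U --> l.
Proof.
move=> xM; have := @segment_compact R (- M) M.
move=> /(_ (x @ U) _)[|l [_ cl]].
  suff -> : (x @ U) `[- M, M] = U setT by apply: filterT.
  by congr (U _); apply/seteqP; split=> n //= _; rewrite in_itv /= -ler_norml.
exists l => B lB; have [//|UB] := in_ultra_setVsetC (x @^-1` B) ultraU.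
by have [y []] := cl (~` B) B UB lB.
Qed.

Lemma cvg_real_complex (x : nat -> R) (l : R) : x @ U --> l -> (fun n => (x n)%:C : C) @ U --> l%:C.
Proof.
move=> /cvgrPdist_lt xl; apply/cvgrPdist_lt => e e0.
have eE : e = (complex.Re e)%:C.
  by case: e e0 => a b; rewrite ltcE /= => /andP[/eqP -> _].
have : 0 < complex.Re e by move: e0; rewrite eE ltcR.
move=> /xl; apply: filterS => n; rewrite [in X in _ -> X]eE -rmorphB /= => H.
by rewrite normc_def /= expr0n addr0 sqrtr_sqr ltcR.
Qed.

Lemma ultra_cvg (x : nat -> C) : (forall n, `|x n| <= 1) -> exists l : C, x @ U --> l.
Proof.
move=> x1.
have [a xa] : exists a : R, (fun n => complex.Re (x n)) @ U --> a.
  by apply: (@ultra_cvg_real _ 1) => n; rewrite -lecR; apply: le_trans (normc_ge_Re _) _.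
have [b xb] : exists b : R, (fun n => complex.Im (x n)) @ U --> b.
  apply: (@ultra_cvg_real _ 1) => n; rewrite -lecR; apply: le_trans (x1 n).
  have -> : complex.Im (x n) = - complex.Re (x n * 'i%C) by rewrite ReiNIm opprK.
  rewrite normrN; apply: le_trans (normc_ge_Re _) _.
  by rewrite normrM [X in _ * X]normc_def /= expr0n expr1n add0r sqrtr1 mulr1.
exists (a%:C + 'i%C * b%:C).
have -> : x = (fun n => (complex.Re (x n))%:C) \+ (cst 'i%C \* (fun n => (complex.Im (x n))%:C)).
  by apply/funext => n; rewrite /= -complexE.
apply: cvgD; first exact: cvg_real_complex.
by apply: cvgM; [apply: cvg_cst | apply: cvg_real_complex].
Qed.


Section LimitFunctional.
Variables (m k : nat) (p : nat -> 'I_k -> 'rV[C]_m) (lambda : nat -> 'I_k -> C).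
Hypothesis p0 : forall j c, (fun n => p n j 0 c) @ U --> (0 : C).

Definition monomial (x : 'rV[C]_m) (w : seq 'I_m) : C := \prod_(c <- w) x 0 c.

Let ev n w := \sum_i lambda n i * monomial (p n i) w.
Let tends w := exists l : C, (fun n => ev n w) @ U --> l.

(* [shifted] evaluates the product of [x_c - p_j c] over [(j, c)] in [s] with the word [w]; it vanishes
   as soon as every [j] occurs in [s], which controls the words of length at least [k]. *)
Let shifted n (s : seq ('I_k * 'I_m)) w :=
  \sum_i lambda n i * \prod_(jc <- s) (p n i 0 jc.2 - p n jc.1 0 jc.2) * monomial (p n i) w.

Lemma shifted_cons n j c s w :
  shifted n ((j, c) :: s) w = shifted n s (c :: w) - p n j 0 c * shifted n s w.
Proof.
rewrite /shifted mulr_sumr -sumrB; apply: eq_bigr => i _.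
by rewrite big_cons /monomial big_cons /=; ring.
Qed.

Lemma shifted_nil n w : shifted n [::] w = ev n w.
Proof. by apply: eq_bigr => i _; rewrite big_nil mulr1. Qed.

Lemma shifted_tends d s w : (forall w, (size w <= d)%N -> tends w) ->
  (size s + size w <= d)%N -> exists l : C, (fun n => shifted n s w) @ U --> l.
Proof.
move=> Td; elim: s w => [|[j c] s IH] w sw.
  have [l Hl] := Td w sw; exists l.
  by have -> : (fun n => shifted n [::] w) = (fun n => ev n w) by apply/funext => n; rewrite shifted_nil.
have [|l1 H1] := IH (c :: w); first by rewrite /= addnS.
have [|l2 H2] := IH w; first by apply: leq_trans sw; rewrite /= leq_add2r.
exists (l1 - 0 * l2).
have -> : (fun n => shifted n ((j, c) :: s) w) =
    (fun n => shifted n s (c :: w)) - ((fun n => p n j 0 c) * (fun n => shifted n s w)).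
  by apply/funext => n; rewrite shifted_cons.
by apply: cvgB H1 _; apply: cvgM H2; apply: p0.
Qed.

(** Replacing a factor [x_c - p_j c] by [x_c] changes the sum by [p_j c], which tends to 0, times a
    convergent quantity. Each freed letter moves to the front of [w], hence the [rev]. *)
Lemma shifted_vanish d s w : (forall w, (size w <= d)%N -> tends w) ->
  (size s + size w <= d.+1)%N -> (fun n => shifted n s w) @ U --> (0 : C) ->
  (fun n => ev n (rev (map snd s) ++ w)) @ U --> (0 : C).
Proof.
move=> Td; elim: s w => [|[j c] s IH] w sw.
  by have -> : (fun n => shifted n [::] w) = (fun n => ev n w) by apply/funext => n; rewrite shifted_nil.
move=> H; rewrite /= rev_cons cat_rcons; apply: IH; first by rewrite /= addnS.
have [l Hl] := @shifted_tends d s w Td sw.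
have -> : (fun n => shifted n s (c :: w)) =
   (fun n => shifted n ((j, c) :: s) w) + (fun n => p n j 0 c) * (fun n => shifted n s w).
  by apply/funext => n; rewrite !fctE shifted_cons subrK.
rewrite -[X in _ --> X]addr0 -[X in _ --> _ + X](mul0r l).
by apply: cvgD H _; apply: cvgM Hl; apply: p0.
Qed.

Lemma ev_long d w : (forall w, (size w <= d)%N -> tends w) -> (k <= size w <= d.+1)%N ->
  (fun n => ev n w) @ U --> (0 : C).
Proof.
move=> Td /andP[kw wd].
pose s := zip (enum 'I_k) (rev (take k w)).
have sz : size (enum 'I_k) = size (rev (take k w)) by rewrite size_rev size_takel // size_enum_ord.
have wE : w = rev (map snd s) ++ drop k w.
  by rewrite -/(unzip2 s) unzip2_zip ?sz // revK cat_take_drop.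
rewrite wE; apply: (@shifted_vanish d) => //.
  by rewrite size_zip sz minnn size_rev -size_cat cat_take_drop.
have -> : (fun n => shifted n s (drop k w)) = cst 0; last exact: cvg_cst.
apply/funext => n; rewrite /shifted big1 // => i _.
suff -> : \prod_(jc <- s) (p n i 0 jc.2 - p n jc.1 0 jc.2) = 0 by rewrite mulr0 mul0r.
have /mapP[[j c] js /= ij] : i \in map fst s.
  by rewrite -/(unzip1 s) unzip1_zip ?sz // mem_enum.
by apply/eqP; rewrite prodf_seq_eq0; apply/hasP; exists (j, c) => //=; rewrite -ij subrr.
Qed.

Lemma cvg_det s (A : nat -> 'M[C]_s) (B : 'M[C]_s) :
  (forall i j, (fun n => A n i j) @ U --> B i j) -> (fun n => \det (A n)) @ U --> \det B.
Proof.
move=> AB; pose Q (x : nat -> C) (l : C) := x @ U --> l.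
suff : Q (\sum_(g : {perm 'I_s}) cst ((-1) ^+ g) * \prod_i (fun n => A n i (g i))) (\det B).
  by congr Q; apply/funext => n; rewrite fct_sumE; apply: eq_bigr => g _; rewrite !fctE fct_prodE.
apply: (big_rec2 Q) => [|g x l _ IH]; first exact: cvg_cst.
apply: cvgD IH; apply: cvgM; first exact: cvg_cst.
apply: (big_rec2 Q) => [|i x' l' _ IH]; first exact: cvg_cst.
by apply: cvgM IH.
Qed.

(** Short words converge by boundedness, and the longer ones tend to 0 by induction on the length.
    For each [n] the Hankel matrix factors through a space of dimension [k]; the vanishing of its
    minors of size [k.+1] passes to the limit. *)
Lemma limit_lowrank : (0 < k)%N -> (forall n w, (size w < k)%N -> `|ev n w| <= 1) ->
  exists phi : seq 'I_m -> C, lowrank k phi /\ forall w, (fun n => ev n w) @ U --> phi w.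
Proof.
move=> k0 ev1.
have Td d w : (size w <= d)%N -> tends w.
  elim: d w => [|d IH] w sw.
    by apply: ultra_cvg => n; apply: ev1; apply: leq_ltn_trans sw k0.
  have [wk|kw] := ltnP (size w) k; first by apply: ultra_cvg => n; apply: ev1.
  by exists 0; apply: (ev_long IH); rewrite kw.
have [phi phiE] := choice (fun w => Td _ w (leqnn (size w))).
exists phi; split=> //.
have uniq_lim (x : nat -> C) (a b : C) : x @ U --> a -> x @ U --> b -> a = b.
  by move=> xa xb; apply: cvg_unique xa xb.
split.
- move=> w w' pw; apply: uniq_lim (phiE w) _.
  suff -> : (fun n => ev n w) = (fun n => ev n w') by [].
  by apply/funext => n; apply: eq_bigr => i _; rewrite /monomial (perm_big _ pw).
- exists k => w kw; apply: uniq_lim (phiE w) _; apply: (@ev_long (size w)); first exact: Td.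
  by rewrite kw leqnSn.
- move=> a b; have H : (fun n => \det (hankel (ev n) a b)) @ U --> \det (hankel phi a b).
    apply: cvg_det => i j; rewrite mxE.
    have -> : (fun n => hankel (ev n) a b i j) = (fun n => ev n (a i ++ b j)) by apply/funext => n; rewrite mxE.
    exact: phiE.
  apply: uniq_lim H _; have -> : (fun n => \det (hankel (ev n) a b)) = cst 0; last exact: cvg_cst.
  apply/funext => n /=.
  pose A : 'M[C]_(k.+1, k) := \matrix_(i, l) (lambda n l * monomial (p n l) (a i)).
  pose B : 'M[C]_(k, k.+1) := \matrix_(l, j) monomial (p n l) (b j).
  have -> : hankel (ev n) a b = A *m B.
    apply/matrixP=> i j; rewrite !mxE; apply: eq_bigr => l _; rewrite !mxE.
    by rewrite /monomial big_cat /= mulrA.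
  apply/eqP/negPn/negP => D0; have : (A *m B) \in unitmx by rewrite unitmxE unitfE.
  rewrite -row_free_unit => /eqP rk; have := mxrankM_maxr A B; rewrite rk.
  by move/leq_trans/(_ (rank_leq_row _)); rewrite ltnn.
Qed.

End LimitFunctional.

End UltraLimits.

(** * Regular maps *)

Section ShortWords.
Variables (m k : nat).

(* Padding with [None] makes the words of length at most [k] range over functions, so that a product
   of [k] affine forms expands by distributivity. *)
Definition short_word (t : {ffun 'I_k -> option 'I_m}) : seq 'I_m := pmap t (enum 'I_k).

Lemma short_word_surj w : (size w <= k)%N -> exists t, short_word t = w.
Proof.
move=> wk; exists [ffun j : 'I_k => onth w j]; rewrite /short_word.
have -> : pmap [ffun j : 'I_k => onth w j] (enum 'I_k) = pmap (onth w) (map val (enum 'I_k)).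
  by elim: (enum 'I_k) => //= j s ->; rewrite ffunE.
rewrite val_enum_ord; elim: w k wk => [|c w IH] [|d] //= => [_|wd].
  by elim: (iota 1 d) => //= a s ->; rewrite onth0n.
rewrite -[X in iota X _]addn0 iotaDl -[in RHS](IH d wd); congr (_ :: _).
by elim: (iota 0 d) => //= j s ->.
Qed.

End ShortWords.

(** For each other point take an affine form [x_c - const] that vanishes there but not at [p i0].
    Their product isolates [p i0] and has degree at most [k], so the sum over some word of its
    expansion must be nonzero. *)
Lemma eval_interpolation (E : numClosedFieldType) m k (p : 'I_k.+1 -> 'rV[E]_m) (lambda : 'I_k.+1 -> E) i0 :
  injective p -> lambda i0 != 0 ->
  exists t : {ffun 'I_k -> option 'I_m},
    \sum_i lambda i * \prod_(c <- short_word t) p i 0 c != 0.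
Proof.
move=> injp l0; apply: contrapT => none.
have H0 (t : {ffun 'I_k -> option 'I_m}) : \sum_i lambda i * \prod_(c <- short_word t) p i 0 c = 0.
  by apply: contrapT => /eqP H; apply: none; exists t.
have sep (j : 'I_k) : exists c, p i0 0 c != p (lift i0 j) 0 c.
  apply: contrapT => same; have : p i0 = p (lift i0 j).
    by apply/rowP=> c; apply: contrapT => /eqP H; apply: same; exists c.
  by move/injp/eqP; rewrite (negPf (neq_lift _ _)).
have [c cP] := choice sep.
pose coef (j : 'I_k) (o : option 'I_m) := if o is Some c' then (c' == c j)%:R else - p (lift i0 j) 0 (c j).
have factor i : \prod_(j < k) (p i 0 (c j) - p (lift i0 j) 0 (c j)) =
    \sum_(t : {ffun 'I_k -> option 'I_m}) (\prod_j coef j (t j)) * \prod_(c <- short_word t) p i 0 c.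
  transitivity (\prod_(j < k) \sum_(o : option 'I_m) coef j o * oapp (fun c => p i 0 c) 1 o).
    apply: eq_bigr => j _; rewrite (bigD1 None) //= mulr1 addrC; congr (_ + _).
    rewrite (bigD1 (Some (c j))) //= eqxx mul1r big1 ?addr0 // => -[c'|] //= nc.
    by rewrite (_ : (c' == c j) = false) ?mul0r //; apply: contraNF nc => /eqP ->.
  rewrite bigA_distr_bigA; apply: eq_bigr => t _; rewrite big_split /=; congr (_ * _).
  by rewrite /short_word big_pmap big_enum.
have : \sum_i lambda i * \prod_(j < k) (p i 0 (c j) - p (lift i0 j) 0 (c j)) = 0.
  under eq_bigr => i _ do rewrite factor mulr_sumr.
  rewrite exchange_big big1 //= => t _.
  under eq_bigr do rewrite mulrCA; by rewrite -mulr_sumr H0 mulr0.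
rewrite (bigD1 i0) //= [X in _ + X]big1 ?addr0 => [|i ii0]; last first.
  case: (unliftP i0 i) ii0 => [j ->|->]; last by rewrite eqxx.
  by rewrite (bigD1 j) //= subrr mul0r mulr0.
move/eqP; rewrite mulf_eq0 (negPf l0) /= prodf_seq_eq0 => /hasP[j _].
by rewrite subr_eq0 (negPf (cP j)).
Qed.

(** * Regularity on a small polydisc *)

Section LocalRegularity.
Variable R : realType.
Let C : numClosedFieldType := R[i].
Variables (m k N : nat).

Definition word_map (K : comNzRingType) (l : 'I_N -> {ffun 'I_k -> option 'I_m} -> K)
    (x : 'rV[K]_m) : 'rV[K]_N :=
  \row_i \sum_t l i t * \prod_(c <- short_word t) x 0 c.

Lemma local_regular (l : 'I_N -> {ffun 'I_k -> option 'I_m} -> C) :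
  (0 < m)%N -> (k.+1 <= 9)%N \/ (m <= 2)%N -> (m * k + 1 <= N)%N ->
  indep [seq l i t | i <- enum 'I_N, t <- enum {ffun 'I_k -> option 'I_m}] ->
  exists2 e : R, 0 < e & forall p : 'I_k.+1 -> 'rV[C]_m, injective p ->
    (forall i c, `|p i 0 c| <= e%:C) -> row_free (\matrix_i word_map l (p i)).
Proof.
move=> m0 km kN indl; apply: contrapT => none.
have bad n : exists pl : ('I_k.+1 -> 'rV[C]_m) * ('I_k.+1 -> C),
   [/\ forall i c, `|pl.1 i 0 c| <= (n.+1%:R^-1)%:C,
    forall i, \sum_t l i t * (\sum_j pl.2 j * monomial (pl.1 j) (short_word t)) = 0,
    forall w, (size w < k.+1)%N -> `|\sum_j pl.2 j * monomial (pl.1 j) w| <= 1 &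
    exists t : {ffun 'I_k -> option 'I_m}, \sum_j pl.2 j * monomial (pl.1 j) (short_word t) = 1].
  have [p [injp [pn pf]]] : exists p : 'I_k.+1 -> 'rV[C]_m, injective p /\
      (forall i c, `|p i 0 c| <= (n.+1%:R^-1)%:C) /\ ~ row_free (\matrix_i word_map l (p i)).
    apply: contrapT => nop; apply: none; exists n.+1%:R^-1; first by rewrite invr_gt0 ltr0n.
    by move=> p injp pn; apply: contrapT => pf; apply: nop; exists p.
  have [x xM x0] : exists2 x : 'rV[C]_k.+1, x *m (\matrix_i word_map l (p i)) = 0 & x != 0.
    apply: contrapT => nox; apply: pf; apply: inj_row_free => x xM.
    by apply: contrapT => /eqP x0; apply: nox; exists x.
  have [i0 xi0] : exists i, x 0 i != 0.
    apply: contrapT => no0; move/eqP: x0; apply; apply/rowP => i; rewrite mxE.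
    by apply: contrapT => /eqP xi; apply: no0; exists i.
  pose f (t : {ffun 'I_k -> option 'I_m}) := \sum_j x 0 j * monomial (p j) (short_word t).
  have [t1 ft1] : exists t, f t != 0 := eval_interpolation (lambda := fun j => x 0 j) injp xi0.
  (* Dividing by the largest value bounds all values by 1 and makes one of them equal to 1, so the
     limit functional cannot vanish. *)
  have [t2 t2max] : exists t2, forall t, `|f t| <= `|f t2|.
    have normE (z : C) : `|z| = (complex.Re `|z|)%:C by rewrite normc_def.
    case: (@arg_maxP _ _ _ t1 xpredT (fun t => complex.Re `|f t|)) => // t2 _ H.
    by exists t2 => t; rewrite normE [X in _ <= X]normE lecR; apply: H.
  have ft2 : f t2 != 0.
    by apply: contraNneq ft1 => f0; have := t2max t1; rewrite f0 normr0 normr_le0.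
  exists (p, fun j => (f t2)^-1 * x 0 j); split=> //=.
  - move=> i; transitivity ((f t2)^-1 * (x *m \matrix_i word_map l (p i)) 0 i).
      rewrite mxE mulr_sumr; under eq_bigr => t _ do rewrite mulr_sumr.
      rewrite exchange_big /=; apply: eq_bigr => j _; rewrite !mxE !mulr_sumr.
      by apply: eq_bigr => t _; rewrite /monomial; ring.
    by rewrite xM mxE mulr0.
  - move=> w; rewrite ltnS => /short_word_surj[t <-].
    under eq_bigr do rewrite -mulrA; rewrite -mulr_sumr -/(f t) normrM normfV mulrC.
    by rewrite ler_pdivrMr ?mul1r ?normr_gt0.
  - by exists t2; under eq_bigr do rewrite -mulrA; rewrite -mulr_sumr -/(f t2) mulVf.
have [pl plP] := choice bad.
have [U [ultraU oU]] := ultraFilterLemma (@eventually_filter).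
pose p n := (pl n).1; pose lam n := (pl n).2.
have p0 j c : ((fun n => p n j 0 c) @ U --> (0 : C))%classic.
  apply: cvg_trans (cvg_app _ oU) _; apply/cvgrPdist_le => e e0.
  have eE : e = (complex.Re e)%:C by case: e e0 => a b; rewrite ltcE /= => /andP[/eqP -> _].
  have re0 : 0 < complex.Re e by move: e0; rewrite eE ltcR.
  near=> n; rewrite sub0r normrN; have [+ _ _ _] := plP n => /(_ j c)/le_trans; apply.
  rewrite eE lecR; near: n; have := @near_infty_natSinv_lt R (PosNum re0).
  by apply: filterS => n /ltW.
have [phi [lr phiE]] : exists phi : seq 'I_m -> C, lowrank k.+1 phi /\
    forall w, ((fun n => \sum_i lam n i * monomial (p n i) w) @ U --> phi w)%classic.
  by apply: limit_lowrank p0 _ _ => // n w; case: (plP n) => _ _ + _; apply.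
have limZ t (a : C) : ((fun n => a * \sum_j lam n j * monomial (p n j) (short_word t)) @ U -->
    a * phi (short_word t))%classic.
  by apply: cvgM; [apply: cvg_cst | apply: phiE].
have uniq_lim (x : nat -> C) (a b : C) : (x @ U --> a -> x @ U --> b -> a = b)%classic.
  by move=> xa xb; apply: cvg_unique xa xb.
have [t0 phi0] : exists t0 : {ffun 'I_k -> option 'I_m}, phi (short_word t0) != 0.
  (* The word with value 1 may vary with [n]; the product over all words is zero for every [n],
     hence also in the limit. *)
  have : \prod_(t : {ffun 'I_k -> option 'I_m}) (1 - phi (short_word t)) = 0.
    pose Q (x : nat -> C) (l : C) := (x @ U --> l)%classic.
    have : Q (\prod_(t : {ffun 'I_k -> option 'I_m})
         (cst 1 - (fun n => \sum_j lam n j * monomial (p n j) (short_word t))))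
         (\prod_(t : {ffun 'I_k -> option 'I_m}) (1 - phi (short_word t))).
      apply: (big_rec2 Q) => [|t x' l' _ IH]; first exact: cvg_cst.
      by apply: cvgM IH; apply: cvgB; [apply: cvg_cst | apply: phiE].
    move=> H; apply: uniq_lim H _.
    set x := (X in (X @ U)%classic); suff -> : x = cst 0 by apply: cvg_cst.
    apply/funext => n; rewrite /x fct_prodE; have [_ _ _ [t tE]] := plP n.
    by rewrite (bigD1 t) //= !fctE tE subrr mul0r.
  move/eqP; rewrite prodf_seq_eq0 => /hasP[t _]; rewrite subr_eq0 => /eqP pt.
  by exists t; rewrite -pt oner_neq0.
have [||i] := @generic_no_kernel C m k.+1 _ (@short_word m k) N l phi t0 m0 isT km _ _ indl lr phi0.
- by rewrite subn1.
- by move=> S; have [y Hy] := exists_transcendental S; exists y%:C.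
move/eqP; apply.
pose Q (x : nat -> C) (l : C) := (x @ U --> l)%classic.
have : Q (\sum_t (fun n => l i t * \sum_j lam n j * monomial (p n j) (short_word t)))
   (\sum_t l i t * phi (short_word t)).
  apply: (big_rec2 Q) => [|t x' l' _ IH]; first exact: cvg_cst.
  by apply: cvgD IH; apply: limZ.
move=> H; apply: uniq_lim H _.
set x := (X in (X @ U)%classic); suff -> : x = cst 0 by apply: cvg_cst.
by apply/funext => n; rewrite /x fct_sumE; have [_ + _ _] := plP n; apply.
Unshelve. all: by end_near.
Qed.


End LocalRegularity.

(** * Injective continuous contraction of the whole space into a polydisc *)

Section Shrinking.
Variable K : numFieldType.

Lemma continuous_rV m N (f : 'rV[K]_m -> 'rV[K]_N) :
  (forall j, continuous (fun x => f x 0 j)) -> continuous f.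
Proof.
move=> cf x B [P fP PB]; have : \forall y \near x, forall j, P 0 j (f y 0 j).
  by apply: (@filter_forall _ _ (fun j y => P 0 j (f y 0 j)) (nbhs x)) => j; exact: (cf j x _ (fP 0 j)).
by apply: filterS => y Py; apply: PB => i j; rewrite ord1.
Qed.

Definition shrink (e z : K) := e * (z / (1 + `|z|)).

Lemma shrink_den (z : K) : 1 + `|z| != 0.
Proof. by rewrite gt_eqF // ltr_pwDl. Qed.

(** Taking norms first gives [|z| = |w|], because [t / (1 + t)] is injective for nonnegative [t];
    then the two denominators agree. *)
Lemma shrink_inj e : e != 0 -> injective (shrink e).
Proof.
move=> e0 z w /(mulfI e0) zw.
have nzw : `|z| = `|w|.
  have : `|z| / (1 + `|z|) = `|w| / (1 + `|w|).
    have nd (x : K) : `|x| / (1 + `|x|) = `|x / (1 + `|x|)|.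
      by rewrite normrM normfV [`|1 + _|]ger0_norm // addr_ge0.
    by rewrite !nd zw.
  move/eqP; rewrite eqr_div ?shrink_den // !mulrDr !mulr1 [`|w| * `|z|]mulrC => /eqP.
  exact: addIr.
by move: zw; rewrite nzw; apply: divIf; apply: shrink_den.
Qed.

Lemma shrink_le e z : 0 <= e -> `|shrink e z| <= e.
Proof.
move=> e0; rewrite normrM ger0_norm // ler_piMr // normrM normfV.
rewrite [`|1 + _|]ger0_norm ?addr_ge0 // ler_pdivrMr ?ltr_pwDl // mul1r.
by rewrite lerDr.
Qed.

Lemma shrink_continuous e : continuous (shrink e).
Proof.
move=> z; apply: (@cvgM K K (nbhs z) _ (cst e) (fun z => z / (1 + `|z|))); first exact: cvg_cst.
apply: (@cvgM K K (nbhs z) _ id (fun z => (1 + `|z|)^-1)); first exact: cvg_id.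
apply: (@cvgV K K (nbhs z) _ (fun z => 1 + `|z|)); first exact: shrink_den.
apply: (@cvgD K K K (nbhs z) _ (cst 1) (fun z => `|z|)); first exact: cvg_cst.
exact: norm_continuous.
Qed.

Definition shrunk_word_map m k N (l : 'I_N -> {ffun 'I_k -> option 'I_m} -> K) (e : K)
  (x : 'rV[K]_m) := word_map l (map_mx (shrink e) x).

Lemma shrunk_word_map_continuous m k N (l : 'I_N -> {ffun 'I_k -> option 'I_m} -> K) e :
  continuous (shrunk_word_map l e).
Proof.
apply: continuous_rV => j.
pose Q (f : 'rV[K]_m -> K) := continuous f.
have Qcst a : Q (cst a) by move=> x; exact: (@cvg_cst K a _ (nbhs x) _).
have QD f g : Q f -> Q g -> Q (f + g).
  by move=> cf cg x; apply: (@cvgD K K _ (nbhs x) _ f g); [apply: cf | apply: cg].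
have QM f g : Q f -> Q g -> Q (f * g).
  by move=> cf cg x; apply: (@cvgM K _ (nbhs x) _ f g); [apply: cf | apply: cg].
pose F (t : {ffun 'I_k -> option 'I_m}) : 'rV[K]_m -> K :=
  \prod_(c <- short_word t) (fun y : 'rV[K]_m => shrink e (y 0 c)).
suff : Q (\sum_t cst (l j t) * F t).
  suff -> : \sum_t cst (l j t) * F t = (fun x : 'rV[K]_m => shrunk_word_map l e x 0 j) by [].
  apply/funext => y; rewrite fct_sumE /shrunk_word_map mxE.
  apply: eq_bigr => t _; rewrite !fctE /F fct_prodE; congr (_ * _).
  by apply: eq_bigr => c _; rewrite mxE.
apply: (big_ind Q) => [|//|t _]; first exact: Qcst.
apply: (QM (cst _)); first exact: Qcst.
apply: (big_ind Q) => [|f g Qf Qg|c _]; [exact: Qcst | exact: QM |].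
move=> x; apply: (@continuous_comp _ _ _ (fun y : 'rV[K]_m => y 0 c) (shrink e)).
  exact: coord_continuous.
exact: shrink_continuous.
Qed.

End Shrinking.

Lemma exists_indep_family (R : realType) (I J : finType) :
  exists l : I -> J -> R, indep [seq (l i t)%:C : R[i] | i <- enum I, t <- enum J].
Proof.
pose prs := [seq (i, t) | i <- enum I, t <- enum J].
have [s [ss is_]] := exists_indep R (size prs).
exists (fun i t => s`_(index (i, t) prs)).
suff -> : [seq (s`_(index (i, t) prs))%:C : R[i] | i <- enum I, t <- enum J] =
    map (fun y : R => y%:C) s by [].
rewrite -(map_allpairs (fun p => (s`_(index p prs))%:C) (fun i t => (i, t))) -/prs.
apply: (@eq_from_nth _ 0); rewrite !size_map // => a ap.
have [p0 _] : exists p0, p0 \in prs by case: (prs) ap => // p0 ? _; exists p0; rewrite mem_head.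
rewrite (nth_map p0) // (nth_map 0) ?ss // index_uniq //.
by apply: allpairs_uniq; rewrite ?enum_uniq // => -[? ?] [? ?].
Qed.

Theorem theorem1p3 (R : realType) (m k : nat) :
  (1 <= m)%N -> (1 <= k)%N -> (k <= 9)%N \/ (m <= 2)%N ->
  (exists f : 'rV[R]_m -> 'rV[R]_(m * (k - 1) + 1),
      continuous f /\ k_regular k f) /\
  (exists f : 'rV[R[i]]_m -> 'rV[R[i]]_(m * (k - 1) + 1),
      continuous f /\ k_regular k f).
Proof.
case: k => // k m0 _ km; set N := (m * (k.+1 - 1) + 1)%N.
have Nk : (m * k + 1 <= N)%N by rewrite /N subn1.
have [l il] := exists_indep_family R 'I_N {ffun 'I_k -> option 'I_m}.
have [e e0 He] := local_regular m0 km Nk il.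
have eC : e%:C != 0 :> R[i] by rewrite gt_eqF // ltcR.
split.
  exists (shrunk_word_map l e); split; first exact: shrunk_word_map_continuous.
  (* Independence over the reals is tested after extension to the complex numbers, where the shrunk
     real points are among those covered by [He]. *)
  move=> p injp; rewrite -(row_free_map (real_complex R)).
  pose q i : 'rV[R[i]]_m := map_mx (real_complex R) (map_mx (shrink e) (p i)).
  have -> : map_mx (real_complex R) (\matrix_i shrunk_word_map l e (p i)) =
      \matrix_i word_map (fun i t => (l i t)%:C) (q i).
    apply/matrixP=> i j; rewrite !mxE rmorph_sum; apply: eq_bigr => t _.
    by rewrite rmorphM rmorph_prod; congr (_ * _); apply: eq_bigr => c _; rewrite [in RHS]mxE.
  apply: He => [i j qij|i c].
    apply: injp; apply/rowP=> c; apply: (@shrink_inj _ e); first by rewrite gt_eqF.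
    by move/rowP/(_ c): qij; rewrite !mxE => /complexI.
  rewrite !mxE; have -> : `|(shrink e (p i 0 c))%:C| = `|shrink e (p i 0 c)|%:C :> R[i].
    by rewrite normc_def /= expr0n addr0 sqrtr_sqr.
  by rewrite lecR shrink_le // ltW.
exists (shrunk_word_map (fun i t => (l i t)%:C) e%:C); split.
  exact: shrunk_word_map_continuous.
move=> p injp; apply: (He (fun i => map_mx (shrink e%:C) (p i))) => [i j qij|i c].
  by apply: injp; apply/rowP=> c; apply: (shrink_inj eC); move/rowP/(_ c): qij; rewrite !mxE.
by rewrite mxE shrink_le // ltW // ltcR.
Qed.
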